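(* Let $X_i=g(\varepsilon_{i-s};\,s\in\mathbb{Z}^d)$, $i\in\mathbb{Z}^d$, be the real random field described in the context, with marginal density $f$ and physical dependence coefficients $\delta_i=\delta_{i,2}$, and let $f_n$ be the kernel density estimator built from the regions $\Lambda_n$, the bandwidths $b_n$ and the kernel $K$. Assume: (i) $f$ is Lipschitz; (ii) $K$ is Lipschitz, $\int_{\mathbb{R}}K(u)\,du=1$, $\int_{\mathbb{R}}u^2|K(u)|\,du<\infty$ and $\int_{\mathbb{R}}K^2(u)\,du<\infty$; (iii) $b_n\to0$ and $|\Lambda_n|\to\infty$ such that $|\Lambda_n|b_n\to\infty$ as $n\to\infty$; (iv) $\sum_{i\in\mathbb{Z}^d}|i|^{5d/2}\,\delta_i<\infty$. Then there exists $\kappa>0$ such that for all integers $n\geq1$, $$\mathbb{E}\int_{\mathbb{R}}|f_n(x)-f(x)|\,dx\leq\kappa\left(b_n+\frac{1}{\sqrt{|\Lambda_n|b_n}}\right)^{2/3}.$$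
   Context: Let $d\ge1$ be an integer, $(\varepsilon_j)_{j\in\mathbb{Z}^d}$ i.i.d. real random variables, $g$ a measurable function on $\mathbb{R}^{\mathbb{Z}^d}$, and $X_i=g(\varepsilon_{i-s};\,s\in\mathbb{Z}^d)$ for $i\in\mathbb{Z}^d$; the $X_i$ have a common marginal density $f$. For $i=(i_1,\dots,i_d)\in\mathbb{Z}^d$, $|i|=\max_{1\le k\le d}|i_k|$. For a finite set $\Lambda$, $|\Lambda|$ is its cardinality. Physical dependence measure: let $(\varepsilon'_j)_{j\in\mathbb{Z}^d}$ be an i.i.d. copy of $(\varepsilon_j)_{j\in\mathbb{Z}^d}$ (independent of it), $\varepsilon^*_j=\varepsilon_j$ for $j\neq0$ and $\varepsilon^*_0=\varepsilon'_0$, and $X_i^*=g(\varepsilon^*_{i-s};\,s\in\mathbb{Z}^d)$. For $p>0$ and $X_i\in\mathbb{L}^p$, set $\delta_{i,p}=\|X_i-X_i^*\|_p$, and write $\delta_i=\delta_{i,2}$ (so $X_i\in\mathbb{L}^2$ is assumed whenever $\delta_i$ is used). Estimator: $(\Lambda_n)_{n\ge1}$ is a sequence of finite nonempty subsets of $\mathbb{Z}^d$, $(b_n)_{n\ge1}$ a sequence of positive reals, $K:\mathbb{R}\to\mathbb{R}$ a kernel, and $$f_n(x)=\frac{1}{|\Lambda_n|b_n}\sum_{i\in\Lambda_n}K\left(\frac{x-X_i}{b_n}\right),\quad x\in\mathbb{R}.$$ *)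

(* Defs.v *)
From HB Require Import structures.
From mathcomp Require Import all_boot all_order all_algebra finmap.
From mathcomp Require Import all_classical all_reals all_analysis.

Set Implicit Arguments.
Unset Strict Implicit.
Unset Printing Implicit Defensive.

Import Order.TTheory GRing.Theory Num.Theory.
Import numFieldNormedType.Exports.

Local Open Scope classical_set_scope.
Local Open Scope ring_scope.

Notation lattice d := 'rV[int]_d.

Definition sup_norm (d : nat) (i : lattice d) : nat :=
  (\max_(k < d) `|i ord0 k|)%N.

(* The coordinate cylinders of R^I; they generate the product Borel
   sigma-algebra. *)
Definition cylinders (R : realType) (I : Type) : set_system (I -> R) :=
  \bigcup_(i in [set: I])
    preimage_set_system setT (fun x : I -> R => x i) measurable.

Notation product_space R I := (g_sigma_algebraType (@cylinders R I)).

Section probability.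
Context {disp : measure_display} {T : measurableType disp} {R : realType}.
Variable P : probability T R.
Local Open Scope ereal_scope.

Definition mutual_indep (I : choiceType) (Y : I -> {RV P >-> R}) : Prop :=
  forall (J : {fset I}) (A : I -> set R), (forall j, measurable (A j)) ->
    P (\bigcap_(j in [set` J]) (Y j @^-1` A j)) =
    \prod_(j <- enum_fset J) P (Y j @^-1` A j).

Definition same_law (Y Z : {RV P >-> R}) : Prop :=
  forall A, measurable A -> distribution P Y A = distribution P Z A.

Definition iid (I : choiceType) (Y : I -> {RV P >-> R}) : Prop :=
  mutual_indep Y /\ forall i j, same_law (Y i) (Y j).

(* Independence of the sigma-algebras generated by the processes Y and Z. *)
Definition indep_families (I : choiceType) (Y Z : I -> {RV P >-> R}) : Prop :=
  forall A B : set (product_space R I), measurable A -> measurable B ->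
    P ([set w | A (Y ^~ w)] `&` [set w | B (Z ^~ w)]) =
    P [set w | A (Y ^~ w)] * P [set w | B (Z ^~ w)].

Definition iid_copy (I : choiceType) (Y Y' : I -> {RV P >-> R}) : Prop :=
  [/\ iid Y', forall i, same_law (Y' i) (Y i) & indep_families Y Y'].

Definition is_density (X : T -> R) (f : R -> R) : Prop :=
  [/\ measurable_fun setT f, forall x, (0 <= f x)%R &
      forall A, measurable A ->
        P (X @^-1` A) = \int[lebesgue_measure]_(x in A) (f x)%:E].

Section dependence.
Variables (d : nat) (g : (lattice d -> R) -> R).
Implicit Types (e : lattice d -> {RV P >-> R}) (i : lattice d).

Definition random_field e i (w : T) : R := g (fun s => e (i - s)%R w).

Definition coupled e e' (j : lattice d) : {RV P >-> R} :=
  if j == 0%R then e' j else e j.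

(* Extended-real valued, so that it is meaningful before integrability of the
   field is known. *)
Definition phys_dep (p : R) e e' i : \bar R :=
  'N[P]_p%:E[(fun w => (random_field e i w - random_field (coupled e e') i w)%:E)].

End dependence.

End probability.

Definition kde (T : Type) (R : realType) (d : nat) (X : lattice d -> T -> R)
    (K : R -> R) (Lambda : {fset lattice d}) (b : R) (w : T) (x : R) : R :=
  (#|` Lambda|%:R * b)^-1 * \sum_(i <- enum_fset Lambda) K ((x - X i w) / b).

(* Main.v *)
Require Import Defs.
From HB Require Import structures.
From mathcomp Require Import all_boot all_order all_algebra finmap.
From mathcomp Require Import all_classical all_reals all_analysis.
From mathcomp Require Import measurable_realfun ring lra zify.
Import Order.TTheory GRing.Theory Num.Theory.
Import numFieldNormedType.Exports.
Local Open Scope classical_set_scope.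
Local Open Scope ring_scope.
Set Implicit Arguments.
Unset Strict Implicit.
Unset Printing Implicit Defensive.

(** Write N for the cardinal of the region, b for the bandwidth,
s = 1 / sqrt (N b), rho = b + s, and m for the pointwise mean of f_n.

The error is cut at level A = rho^(-1/3).  On [-A, A] it is at most
|f_n - m| + |m - f|, where |f_n - m| <= s / 2 + (f_n - m)^2 / (2 s) and the
bias |m - f| is O(b) because f is Lipschitz ([bias_le]).  Outside [-A, A] it is
at most (x / A)^2 (|f_n x| + f x), and both second moments are bounded in mean
([L1_split], [second_moment_bump]).  Once E int (f_n - m)^2 = O(s^2) is known,
the total is O(A rho + s + A^(-2)) = O(rho^(2/3)) ([kde_L1_bound],
[rate_arithmetic]).

The integrated variance needs no joint density.  For bumps of width b,
int K ((x - s) / b) K ((x - t) / b) dx = b H ((s - t) / b), where H is the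
autocorrelation of K, so a covariance integrated over x depends on (X_i, X_j)
only through U = X_i - X_j.  Let (X, X') be an independent pair with density f
close to (X_i, X_j), and U' = X - X'.  The integrated covariance is then
b E (H (U / b) - H (U' / b)).  As H is bounded, Lipschitz and O(1 / |u|), it
satisfies (H u - H u')^2 |u'| <= C |u - u'| ([autocorr_sqr]), and at u = U / b,
u' = U' / b the factors 1 / b on both sides cancel.  Interpolation with the
boundedness of H gives, for every D > 0,
|H (U / b) - H (U' / b)| <= c D^(3/7) (|U - U'| / D + |U'|^(-3/4))
([young_interpolation]), and E |U'|^(-3/4) is finite since f, being Lipschitz
and integrable, is bounded.  If D bounds E |X_i - X| + E |X_j - X'|, the
covariance is O(b D^(3/7)) ([Rintegral_cross_diff]).

The pair (X, X') is obtained by recomputing X_i with the innovations replaced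
by their copies in the ball of centre j and radius |i - j| / 2, and X_j with
the innovations replaced outside that ball: the two use disjoint innovations
([independent_coupling]).  Replacing the innovations one at a time, each
replacement costs one coefficient delta_(i - k) by stationarity, and all these
sites are at distance at least |i - j| / 2, so
D = O(|i - j|^(-5d/2)).  The passage from finitely many to infinitely many
replacements is a limit in mean: for an i.i.d. family W and a measurable F with
F (W) integrable, F (W o s_n) tends to F (W o s) in L1 when the injections s_n
converge pointwise to the injection s ([L1cont_integrable]).

Hence the covariances are O(b |i - j|^(-15d/14)).  This is summable over Z^d
([lattice_sum]), so the integrated variance is O(1 / (N b)). *)

(** * Change of variables, densities and Lipschitz functions *)

Section change_of_variables.
Context {R : realType}.
Local Notation mu := (@lebesgue_measure R).
Local Open Scope ereal_scope.

Lemma measurable_affine (a c : R) :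
  measurable_fun setT (fun x : measurableTypeR R => a * x + c : measurableTypeR R)%R.
Proof. by apply: measurable_funD => //; exact: measurable_funM. Qed.

Lemma lebesgue_measure_affine (a c : R) (A : set (measurableTypeR R)) :
  (0 < a)%R -> measurable A ->
  mu A = a%:E * pushforward mu
    (fun x : measurableTypeR R => a * x + c : measurableTypeR R)%R A.
Proof.
move=> a0 mA.
pose nu : {measure set (measurableTypeR R) -> \bar R} :=
  mscale (NngNum (ltW a0)) (pushforward mu
    (fun x : measurableTypeR R => a * x + c : measurableTypeR R)%R).
apply: (@lebesgue_measure_unique R (nu (measurable_affine a c))) => // X [[p q]] _ <-.
transitivity (a%:E * mu `]((p - c) / a)%R, ((q - c) / a)%R]%classic); last first.
  congr (_ * mu _); apply/seteqP; split => x /=; rewrite !in_itv/= ltr_pdivrMr// ler_pdivlMr//;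
    by rewrite ltrBlDr lerBrDr [(x * a)%R]mulrC.
rewrite !lebesgue_measure_itv/= !lte_fin ltr_pM2r ?invr_gt0// ltrD2r.
case: ifPn => _; last by rewrite mule0.
by rewrite -!EFinB -EFinM; congr (_%:E); field; rewrite gt_eqF.
Qed.

Lemma ge0_integral_affine (f : R -> \bar R) (a c : R) : (0 < a)%R ->
  measurable_fun setT f -> (forall x, 0 <= f x) ->
  \int[mu]_x f (a * x + c)%R = (a^-1)%:E * \int[mu]_x f x.
Proof.
move=> a0 mf f0.
pose phi (x : measurableTypeR R) : measurableTypeR R := (a * x + c)%R.
pose nu : {measure set (measurableTypeR R) -> \bar R} :=
  mscale (NngNum (ltW a0)) (pushforward mu phi).
have -> : \int[mu]_x f x = \int[nu (measurable_affine a c)]_x f x.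
  apply: eq_measure_integral => A mA _.
  by rewrite [LHS](lebesgue_measure_affine c a0 mA).
rewrite ge0_integral_mscale//= ge0_integral_pushforward//; last exact: measurable_affine.
by rewrite muleA -EFinM mulVf ?gt_eqF// mul1e.
Qed.

Lemma ge0_integral_reflect (f : R -> \bar R) (c : R) :
  measurable_fun setT f -> (forall x, 0 <= f x) ->
  \int[mu]_x f (c - x)%R = \int[mu]_x f x.
Proof.
move=> mf f0.
have := @ge0_integral_affine f 1 c ltr01 mf f0.
rewrite invr1 mul1e => <-.
under [RHS]eq_integral do rewrite mul1r.
pose g (x : R) := f (x + c)%R.
have mg : measurable_fun setT g.
  by apply: (measurableT_comp mf); exact: measurable_funD.
pose phi (x : measurableTypeR R) : measurableTypeR R := (- x)%R.
have mphi : measurable_fun setT phi by exact: oppr_measurable.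
pose nu : {measure set (measurableTypeR R) -> \bar R} := pushforward mu phi.
transitivity (\int[nu mphi]_x g x).
  rewrite ge0_integral_pushforward//.
    by apply: eq_integral => x _; rewrite /g/= addrC.
  by move=> x _; exact: f0.
apply: eq_measure_integral => A mA _; exact: lebesgue_measureN.
Qed.

End change_of_variables.

Section density.
Context {disp : measure_display} {T : measurableType disp} {R : realType}.
Variables (P : probability T R) (X : T -> R) (f : R -> R).
Hypotheses (mX : measurable_fun setT X) (Xf : is_density P X f).
Local Notation mu := (@lebesgue_measure R).
Local Open Scope ereal_scope.
Import HBNNSimple.

(** The change-of-variables formula for a law with a density, from the case of
indicators by monotone approximation with simple functions. *)
Lemma ge0_integral_density (phi : R -> \bar R) :
  measurable_fun setT phi -> (forall x, 0 <= phi x) ->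
  \int[P]_w phi (X w) = \int[mu]_x (phi x * (f x)%:E).
Proof.
move=> mphi phi0; have [mf f0 PXf] := Xf.
pose h := nnsfun_approx measurableT mphi.
have cvh x : phi x = limn (fun n => (h n x)%:E).
  by apply/esym/cvg_lim => //; exact: (cvg_nnsfun_approx measurableT mphi).
have mh n : measurable_fun setT (fun x => (h n x)%:E).
  by apply/measurable_EFinP; exact: (measurable_funP (h n)).
have ndh x m n : (m <= n)%N -> (h m x <= h n x)%R.
  by move=> mn; exact/lefP/nd_nnsfun_approx.
transitivity (limn (fun n => \int[P]_w (h n (X w))%:E)).
  rewrite -monotone_convergence//.
  - by apply: eq_integral => w _; exact: cvh.
  - by move=> n; apply/measurable_EFinP; exact: measurableT_comp.
  - by move=> n w _; rewrite lee_fin.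
  - by move=> w _ m n mn; rewrite lee_fin ndh.
transitivity (limn (fun n => \int[mu]_x ((h n x)%:E * (f x)%:E))); last first.
  rewrite -monotone_convergence//.
  - apply: eq_integral => x _; rewrite cvh.
    apply/cvg_lim => //; apply: cvgeZr => //.
    rewrite -cvh; exact: (cvg_nnsfun_approx measurableT mphi).
  - move=> n; apply: emeasurable_funM.
      apply/measurable_EFinP. exact: (measurable_funP (h n)).
    apply/measurable_EFinP. exact: mf.
  - by move=> n x *; rewrite mule_ge0 ?lee_fin.
  - by move=> x _ m n mn; rewrite lee_wpmul2r ?lee_fin ?ndh.
congr (limn _); apply/funext => n.
transitivity (\sum_(y \in range (h n)) y%:E * P (X @^-1` (h n @^-1` [set y]))).
  transitivity (\int[pushforward P X]_y (h n y)%:E).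
    rewrite ge0_integral_pushforward//; last by move=> y _; rewrite lee_fin.
  by rewrite integralT_nnsfun sintegralE.
have y1_ge0 y x : 0 <= (y * \1_(h n @^-1` [set y]) x)%:E.
  by rewrite EFinM nnfun_muleindic_ge0.
have mi1 y : measurable_fun setT (\1_(h n @^-1` [set y]) : R -> R).
  exact: measurable_indic.
have my1 y : measurable_fun setT (fun x : R => (y * \1_(h n @^-1` [set y]) x)%:E).
  exact/measurable_EFinP/measurable_funM.
transitivity (\int[mu]_x \sum_(y \in range (h n))
    ((y * \1_(h n @^-1` [set y]) x)%:E * (f x)%:E)); last first.
  apply: eq_integral => x _; rewrite fimfunE -fsumEFin//.
  by rewrite ge0_mule_fsuml.
rewrite ge0_integral_fsum//; last 2 first.
- move=> y; apply: emeasurable_funM; last exact/measurable_EFinP.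
  exact: my1.
- by move=> y x _; rewrite mule_ge0// lee_fin.
apply: eq_fsbigr => y _; rewrite PXf//.
have [y0|y0] := ltP y 0%R.
  rewrite (preimage_nnfun0 _ y0) integral_set0 mule0 integral0_eq// => x _.
  by rewrite indic0 mulr0 mul0e.
under [RHS]eq_integral do rewrite EFinM -muleA.
rewrite ge0_integralZl//; last 2 first.
- by apply: emeasurable_funM; apply/measurable_EFinP; [exact: mi1|exact: mf].
- by move=> x _; rewrite mule_ge0 ?lee_fin.
congr (_ * _); rewrite [LHS]integral_mkcond.
apply: eq_integral => x _; rewrite patchE indicE.
by case: ifP => _; rewrite ?mul1e ?mul0e.
Qed.

Lemma integral_density (phi : R -> R) : measurable_fun setT phi ->
  \int[P]_w (phi (X w))%:E = \int[mu]_x ((phi x)%:E * (f x)%:E).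
Proof.
move=> mphi; have [mf f0 PXf] := Xf.
rewrite integralE [RHS]integralE; congr (_ - _).
  rewrite (_ : (fun w => (phi (X w))%:E)^\+ = fun w => ((EFin \o phi)^\+ (X w))).
    rewrite ge0_integral_density//.
      by apply: eq_integral => x _; rewrite !funeposE/= maxe_pMl ?lee_fin// mul0e.
    by apply: measurable_funepos; exact/measurable_EFinP.
  by apply/funext => w; rewrite !funeposE.
rewrite (_ : (fun w => (phi (X w))%:E)^\- = fun w => ((EFin \o phi)^\- (X w))).
  rewrite ge0_integral_density//.
    apply: eq_integral => x _; rewrite !funenegE/= maxe_pMl ?lee_fin//.
    by rewrite mul0e -EFinM mulNr.
  apply: measurable_funeneg; exact/measurable_EFinP.
by apply/funext => w; rewrite !funenegE.
Qed.

Lemma density_integral1 : \int[mu]_x (f x)%:E = 1.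
Proof.
have [_ _ PXf] := Xf.
by rewrite -PXf// preimage_setT probability_setT.
Qed.

End density.

Section lipschitz.
Context {R : realType}.
Local Notation mu := (@lebesgue_measure R).

Lemma lipschitz_ex (f : R -> R) : lipschitz f ->
  exists2 L, 0 < L & forall x y, `|f x - f y| <= L * `|x - y|.
Proof.
move=> /pinfty_ex_gt0[L L0 fL]; exists L => // x y.
exact: (fL (x, y)).
Qed.

Lemma lipschitz_continuous (f : R -> R) (L : R) : 0 < L ->
  (forall x y, `|f x - f y| <= L * `|x - y|) -> continuous f.
Proof.
move=> L0 fL x; apply/cvgrPdist_le => e e0.
near=> y; apply: (le_trans (fL _ _)).
rewrite mulrC -ler_pdivlMr//; near: y.
apply: cvgr_dist_le; [exact: cvg_id|exact: divr_gt0].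
Unshelve. all: by end_near. Qed.

(** On the unit interval to the right of x the function is at least [h x - L],
so its integral controls [h x]. *)
Lemma lipschitz_integrable_bounded (h : R -> R) (L I : R) : 0 < L ->
  (forall x, 0 <= h x) ->
  (forall x y, `|h x - h y| <= L * `|x - y|) ->
  (\int[mu]_x (h x)%:E <= I%:E)%E ->
  forall x, h x <= I + L.
Proof.
move=> L0 h0 hL hI x.
have mh : measurable_fun setT h.
  by apply: continuous_measurable_fun; exact: lipschitz_continuous hL.
have itv1 : mu `[x, x + 1]%classic = 1%E.
  by rewrite lebesgue_measure_itv/= lte_fin ltrDl ltr01 -EFinB addrAC subrr add0r.
rewrite -lerBlDr -lee_fin; apply: le_trans hI.
apply: (@le_trans _ _ (\int[mu]_(y in `[x, (x + 1)%R]) (h y)%:E)%E); last first.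
  apply: ge0_subset_integral => //.
  - by apply/measurable_EFinP; exact: mh.
  - by move=> y _; rewrite lee_fin.
have [hxL|hxL] := leP (h x - L) 0.
  by apply: (@le_trans _ _ 0%E); rewrite ?lee_fin//; apply: integral_ge0 => y _; rewrite lee_fin.
apply: (@le_trans _ _ (\int[mu]_(y in `[x, (x + 1)%R]) (h x - L)%R%:E)%E).
  by rewrite integral_cst// [X in (_ * X)%E]itv1 mule1.
apply: ge0_le_integral => //.
- by move=> y _; rewrite lee_fin ltW.
- by apply/measurable_EFinP; exact: measurable_funTS.
move=> y; rewrite /= in_itv/= => /andP[xy yx]; rewrite lee_fin.
have := hL x y; rewrite ler_norml => /andP[_].
have : `|x - y| <= 1 by rewrite distrC ger0_norm; lra.
move=> d1; have := ler_wpM2l (ltW L0) d1; lra.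
Qed.

End lipschitz.

(** * Laws of independent families on the product space *)

Section product_law.
Context {disp : measure_display} {T : measurableType disp} {R : realType}.
Variable P : probability T R.

Lemma measurable_coord (I : Type) (i : I) :
  measurable_fun [set: product_space R I] (fun x : product_space R I => x i).
Proof.
move=> _ A mA; rewrite setTI; apply: sub_sigma_algebra.
by exists i => //; exists A => //; rewrite setTI.
Qed.

Lemma measurable_family d' (T' : measurableType d') (I : Type)
    (Y : I -> T' -> R) : (forall i, measurable_fun setT (Y i)) ->
  measurable_fun setT (fun w => Y ^~ w : product_space R I).
Proof.
move=> mY; apply: (@measurability _ _ T' (product_space R I) setT _ (@cylinders R I)) => //.
move=> _ [B [i _ [A mA <-]] <-].
rewrite setTI; have := mY i measurableT A mA; rewrite setTI => h.
by rewrite setTI.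
Qed.

Lemma measurable_reindex (I J : Type) (s : J -> I) :
  measurable_fun [set: product_space R I]
    (fun x : product_space R I => (fun j => x (s j)) : product_space R J).
Proof.
by apply: (@measurable_family _ (product_space R I) J (fun j x => x (s j))) => j;
  exact: measurable_coord.
Qed.

(** The finite-dimensional rectangle with side [A j] at each coordinate [j] of
[s], unrestricted elsewhere. *)
Definition rectangle (I : choiceType) (s : seq I) (A : I -> set R) :
  set (product_space R I) := [set x | forall j, j \in s -> A j (x j)].

Lemma measurable_rectangle (I : choiceType) (s : seq I) (A : I -> set R) :
  (forall j, measurable (A j)) -> measurable (rectangle s A).
Proof.
move=> mA; elim: s => [|i s IH].
  rewrite (_ : rectangle _ _ = setT)//.
  by apply/seteqP; split.
rewrite (_ : rectangle _ _ = [set x | A i (x i)] `&` rectangle s A).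
  apply: measurableI => //.
  by rewrite -[X in measurable X]setTI; exact: measurable_coord.
apply/seteqP; split => x /=.
  by move=> h; split => [|j js]; apply: h; rewrite inE ?eqxx// js orbT.
by move=> [h1 h2] j; rewrite inE => /orP[/eqP->//|/h2].
Qed.

(** The family of all measurable finite-dimensional rectangles: an
intersection-stable generator of the product sigma-algebra. *)
Definition rectangles (I : choiceType) : set_system (product_space R I) :=
  [set B | exists l A,
    [/\ uniq l, (forall j, measurable (A j)) & B = rectangle l A]].

Lemma rectangles_setT (I : choiceType) : @rectangles I setT.
Proof. by exists [::], (fun=> setT); split => //; apply/seteqP; split. Qed.

Lemma rectangles_setI (I : choiceType) : setI_closed (@rectangles I).
Proof.
move=> _ _ [l [B [ul mB ->]]] [l' [B' [ul' mB' ->]]].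
exists (undup (l ++ l')),
  (fun j => (if j \in l then B j else setT) `&` (if j \in l' then B' j else setT)).
split; first exact: undup_uniq.
  by move=> j; apply: measurableI; case: ifP.
apply/seteqP; split => x /=.
  move=> [h h'] j _; split; case: ifPn => // jl; first exact: h.
  exact: h'.
move=> h; split => j jl; have := h j; rewrite mem_undup mem_cat jl ?orbT.
  by move=> /(_ isT)[].
by move=> /(_ isT)[].
Qed.

Lemma measurable_rectanglesE (I : choiceType) :
  @measurable _ (product_space R I) = <<s @rectangles I >>.
Proof.
apply/seteqP; split => B.
  apply: smallest_sub; first exact: smallest_sigma_algebra.
  move=> _ [i _ [C mC <-]]; apply: sub_sigma_algebra.
  exists [:: i], (fun=> C); split => //.
  rewrite setTI; apply/seteqP; split => x /=.
    by move=> Cx j; rewrite inE => /eqP ->.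
  by apply; rewrite inE.
apply: smallest_sub; first exact: sigma_algebra_measurable.
by move=> _ [l [C [ul mC ->]]]; exact: measurable_rectangle.
Qed.

Lemma rectangle_law (I : choiceType) (Y : I -> {RV P >-> R}) (s : seq I)
    (A : I -> set R) : mutual_indep Y -> uniq s ->
  (forall j, measurable (A j)) ->
  P [set w | rectangle s A (Y ^~ w)] = (\prod_(j <- s) P (Y j @^-1` A j))%E.
Proof.
move=> hY us mA; have := hY [fset x in s]%fset A mA.
rewrite (perm_big s) /=; last first.
  by apply: uniq_perm => // x; rewrite in_fset_ /=.
move=> <-; congr (P _); apply/seteqP; split => w /=.
  by move=> h j /=; rewrite in_fset_ /= => /h.
by move=> h j js; apply: h => /=; rewrite in_fset_.
Qed.

(** Along an injection [s], the family [W \o s] is again independent. Sides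
are transported to [I] by choosing a preimage, and are trivial off the range
of [s]. *)
Lemma rectangle_law_inj (I J : choiceType) (W : I -> {RV P >-> R})
    (hW : mutual_indep W) (s : J -> I) (l : seq J) (A : J -> set R) :
  injective s -> uniq l -> (forall j, measurable (A j)) ->
  P [set w | rectangle l A (fun j => W (s j) w)] =
    (\prod_(j <- l) P (W (s j) @^-1` A j))%E.
Proof.
move=> injs ul mA.
pose B i := if pselect (exists j, s j = i) is left e then A (projT1 (cid e))
            else setT.
have Bs j : B (s j) = A j.
  rewrite /B; case: pselect => [e|[]]; last by exists j.
  by congr A; apply: injs; exact: projT2 (cid e).
have := @rectangle_law _ W (map s l) B hW.
rewrite map_inj_uniq// big_map => /(_ ul)/=.
under eq_bigr do rewrite Bs.
move=> <-; last first.
  by move=> i; rewrite /B; case: pselect.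
congr (P _); apply/seteqP; split => w /= h.
  by move=> i /mapP[j jl ->]; rewrite Bs; exact: h.
by move=> j jl; rewrite -Bs; apply: h; exact: map_f.
Qed.

(** The law of a subfamily of an i.i.d. family does not depend on which
injection selects it: the two laws agree on rectangles. *)
Lemma law_reindex (I J : choiceType) (W : I -> {RV P >-> R}) (hW : iid W)
    (s t : J -> I) : injective s -> injective t ->
  forall A : set (product_space R J), measurable A ->
  P [set w | A (fun j => W (s j) w)] = P [set w | A (fun j => W (t j) w)].
Proof.
move=> injs injt.
have mS (u : J -> I) :
    measurable_fun setT (fun w => (fun j => W (u j) w) : product_space R J).
  by apply: measurable_family.
pose m (u : J -> I) : {measure set (product_space R J) -> \bar R} :=
  pushforward P (fun w => (fun j => W (u j) w) : product_space R J).
move=> A mA.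
have H := @measure_unique _ R _ (@rectangles J) (fun=> setT) _ _ _ _
  (m mS s) (m mS t).
apply: H => //.
- exact: measurable_rectanglesE.
- exact: rectangles_setI.
- by move=> _; exact: rectangles_setT.
- by rewrite bigcup_const.
- move=> _ [l [B [ul mB ->]]].
  rewrite /m /pushforward/=.
  transitivity (\prod_(j <- l) P (W (s j) @^-1` B j))%E.
    exact: (rectangle_law_inj hW.1).
  transitivity (\prod_(j <- l) P (W (t j) @^-1` B j))%E; last first.
    by apply/esym; exact: (rectangle_law_inj hW.1).
  apply: eq_bigr => j _; exact: hW.2.
- move=> _; rewrite /m/= [X in (X < _)%E](_ : _ = P setT).
    by rewrite probability_setT ltry.
  by [].
Qed.

Lemma integral_reindex (I J : choiceType) (W : I -> {RV P >-> R}) (hW : iid W)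
    (s t : J -> I) (F : product_space R J -> \bar R) :
  injective s -> injective t ->
  measurable_fun [set: product_space R J] F -> (forall x, 0 <= F x)%E ->
  (\int[P]_w F (fun j => W (s j) w) = \int[P]_w F (fun j => W (t j) w))%E.
Proof.
move=> injs injt mF F0.
have mS (u : J -> I) :
    measurable_fun setT (fun w => (fun j => W (u j) w) : product_space R J).
  by apply: measurable_family.
transitivity (\int[pushforward P
    (fun w => (fun j => W (s j) w) : product_space R J)]_x F x)%E.
  by rewrite ge0_integral_pushforward.
transitivity (\int[pushforward P
    (fun w => (fun j => W (t j) w) : product_space R J)]_x F x)%E; last first.
  by rewrite ge0_integral_pushforward.
apply: eq_measure_integral => A mA _; exact: (law_reindex hW).
Qed.

(** The two families [Y] and [Z] as a single one, indexed by a site and a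
flag; the flag [true] selects the copy [Z]. *)
Definition join (I : choiceType) (Y Z : I -> {RV P >-> R}) (p : I * bool) :=
  if p.2 then Z p.1 else Y p.1.

Lemma join_iid (I : choiceType) (Y Z : I -> {RV P >-> R}) :
  iid Y -> iid_copy Y Z -> iid (join Y Z).
Proof.
move=> [iY sY] [[iZ sZ] sZY iYZ]; split; last first.
  move=> [i [] ] [j [] ] A mA; rewrite /join/=; [exact: sZ| |  |exact: sY].
    by rewrite sZY//; exact: sY.
  by rewrite [RHS]sZY//; exact: sY.
move=> F A mA.
pose B (c : bool) k := A (k, c).
pose s c := [seq p.1 | p <- enum_fset F & p.2 == c].
have us c : uniq (s c).
  rewrite map_inj_in_uniq ?filter_uniq ?fset_uniq//.
  move=> [i b] [j b']; rewrite !mem_filter/= => /andP[/eqP-> _] /andP[/eqP-> _].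
  by move=> ->.
have ms c k : (k \in s c) = ((k, c) \in F).
  apply/mapP/idP => [[[i b]]|kF].
    by rewrite mem_filter/= => /andP[/eqP -> iF] ->.
  by exists (k, c) => //; rewrite mem_filter/= eqxx.
have -> : \bigcap_(j in [set` F]) (join Y Z j @^-1` A j) =
   [set w | rectangle (s false) (B false) (Y ^~ w)] `&`
   [set w | rectangle (s true) (B true) (Z ^~ w)].
  apply/seteqP; split => w /=.
    move=> h; split => k; rewrite ms => kF; exact: (h _ kF).
  move=> [h h'] [k []] /= kF; rewrite /join/=.
    by apply: h'; rewrite ms.
  by apply: h; rewrite ms.
rewrite iYZ; [|by apply: measurable_rectangle => j; exact: mA..].
rewrite rectangle_law// ?rectangle_law//; try by move=> j; exact: mA.
rewrite !big_map !big_filter [RHS](bigID (fun p => p.2 == false))/=; congr (_ * _)%E.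
  by apply: eq_bigr => -[k b] /= /eqP ->.
rewrite [RHS](eq_bigl (fun p => p.2 == true)); last by case=> ? [].
by apply: eq_bigr => -[k b] /= /eqP ->.
Qed.

End product_law.

(** * Continuity in mean of functions of an i.i.d. family under reindexing *)

Section L1_continuity.
Import HBSimple.
Context {disp : measure_display} {T : measurableType disp} {R : realType}.
Variable P : probability T R.

(** Triangle inequality for the L1 distance. *)
Lemma le_integral_dist (a b c : T -> R) :
  measurable_fun setT a -> measurable_fun setT b -> measurable_fun setT c ->
  (\int[P]_w `|a w - c w|%:E <=
   \int[P]_w `|a w - b w|%:E + \int[P]_w `|b w - c w|%:E)%E.
Proof.
move=> ma mb mc; rewrite -ge0_integralD//; last 2 first.
- by apply/measurable_EFinP; apply: measurableT_comp => //; exact: measurable_funB.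
- by apply/measurable_EFinP; apply: measurableT_comp => //; exact: measurable_funB.
apply: ge0_le_integral => //.
- by apply/measurable_EFinP; apply: measurableT_comp => //; exact: measurable_funB.
- by apply: emeasurable_funD; apply/measurable_EFinP; apply: measurableT_comp => //; exact: measurable_funB.
- by move=> w _; rewrite -EFinD lee_fin ler_distD.
Qed.

Variables (I J : choiceType) (W : I -> {RV P >-> R}) (hW : iid W).
Variables (s : nat -> J -> I) (s0 : J -> I).
Hypotheses (injs : forall n, injective (s n)) (injs0 : injective s0).
Hypothesis s_s0 : forall j, \forall n \near \oo, s n j = s0 j.

Let V n w : product_space R J := fun j => W (s n j) w.
Let V0 w : product_space R J := fun j => W (s0 j) w.

Let mV n : measurable_fun setT (V n).
Proof. exact: measurable_family. Qed.

Let mV0 : measurable_fun setT V0.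
Proof. exact: measurable_family. Qed.

(** [F (V n)] converges to [F V0] in L1. *)
Let L1cont (F : product_space R J -> R) := forall e : R, 0 < e ->
  \forall n \near \oo, (\int[P]_w `|F (V n w) - F (V0 w)|%:E <= e%:E)%E.

(** Closure under L1 limits: the error [F - G] has the same L1 norm along
every [s n] as along [s0], by invariance of the law. *)
Lemma L1cont_limit (F : product_space R J -> R) :
  measurable_fun [set: product_space R J] F ->
  (forall e : R, 0 < e -> exists G : product_space R J -> R,
    [/\ measurable_fun [set: product_space R J] G, L1cont G &
     (\int[P]_w `|F (V0 w) - G (V0 w)|%:E <= e%:E)%E]) ->
  L1cont F.
Proof.
move=> mF FG e e0.
have e30 : 0 < e / 3 by lra.
have [G [mG cG FGe]] := FG _ e30.
apply: filterS (cG _ e30) => n Gn.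
have mFV n' : measurable_fun setT (fun w => F (V n' w)) by exact: measurableT_comp.
have mGV n' : measurable_fun setT (fun w => G (V n' w)) by exact: measurableT_comp.
have mFV0 : measurable_fun setT (fun w => F (V0 w)) by exact: measurableT_comp.
have mGV0 : measurable_fun setT (fun w => G (V0 w)) by exact: measurableT_comp.
apply: (le_trans (@le_integral_dist _ (fun w => G (V n w)) _ _ _ _)) => //.
rewrite (_ : e = e / 3 + (e / 3 + e / 3)); last by lra.
rewrite 2!EFinD; apply: leeD.
  have -> : (\int[P]_w `|F (V n w) - G (V n w)|%:E =
      \int[P]_w `|F (V0 w) - G (V0 w)|%:E)%E; last exact: FGe.
  apply: (integral_reindex hW (F := fun x => `|F x - G x|%:E)) => //.
  by apply/measurable_EFinP; apply: measurableT_comp => //; exact: measurable_funB.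
apply: (le_trans (@le_integral_dist _ (fun w => G (V0 w)) _ _ _ _)) => //.
apply: leeD => //.
by under eq_integral do rewrite distrC.
Qed.

Lemma L1cont_cst (c : R) : L1cont (fun=> c).
Proof.
move=> e e0; apply: nearW => n.
under eq_integral do rewrite subrr normr0.
by rewrite integral0 lee_fin ltW.
Qed.

Lemma L1cont_D (F G : product_space R J -> R) :
  measurable_fun [set: product_space R J] F ->
  measurable_fun [set: product_space R J] G ->
  L1cont F -> L1cont G -> L1cont (fun x => F x + G x).
Proof.
move=> mF mG cF cG e e0.
have e20 : 0 < e / 2 by lra.
near=> n.
have mV' (H : product_space R J -> R) : measurable_fun [set: product_space R J] H ->
    measurable_fun setT (fun w => H (V n w) - H (V0 w) : R).
  by move=> mH; apply: measurable_funB; exact: measurableT_comp.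
rewrite (splitr e) EFinD.
apply: (@le_trans _ _ (\int[P]_w `|F (V n w) - F (V0 w)|%:E +
  \int[P]_w `|G (V n w) - G (V0 w)|%:E)%E); last first.
  by apply: leeD; near: n; [exact: cF|exact: cG].
rewrite -ge0_integralD//; last 2 first.
- by apply/measurable_EFinP; apply: measurableT_comp => //; exact: mV'.
- by apply/measurable_EFinP; apply: measurableT_comp => //; exact: mV'.
apply: ge0_le_integral => //.
- apply/measurable_EFinP; apply: measurableT_comp => //.
  apply: (mV' (fun x => F x + G x)); exact: measurable_funD.
- apply: emeasurable_funD; apply/measurable_EFinP; apply: measurableT_comp => //; exact: mV'.
- move=> w _; rewrite -EFinD lee_fin.
  by rewrite opprD addrACA ler_normD.
Unshelve. all: by end_near. Qed.

Lemma L1cont_Z (c : R) (F : product_space R J -> R) :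
  measurable_fun [set: product_space R J] F ->
  L1cont F -> L1cont (fun x => c * F x).
Proof.
move=> mF cF e e0.
have c0 : 0 < `|c| + 1 by rewrite ltr_wpDl.
apply: filterS (cF _ (divr_gt0 e0 c0)) => n Fn.
under eq_integral do rewrite -mulrBr normrM EFinM.
rewrite ge0_integralZl//; last first.
  apply/measurable_EFinP; apply: measurableT_comp => //.
  by apply: measurable_funB; exact: measurableT_comp.
apply: (@le_trans _ _ ((`|c| + 1)%:E * (e / (`|c| + 1))%:E)%E).
  apply: lee_pmul => //; first exact: integral_ge0.
  by rewrite lee_fin lerDl.
by rewrite -EFinM lee_fin mulrC divfK ?gt_eqF.
Qed.

Lemma L1cont_sum (K : Type) (l : seq K) (F : K -> product_space R J -> R) :
  (forall k, measurable_fun [set: product_space R J] (F k)) ->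
  (forall k, L1cont (F k)) -> L1cont (fun x => \sum_(k <- l) F k x).
Proof.
move=> mF cF; elim: l => [|k l IH].
  under eq_fun do rewrite big_nil; exact: L1cont_cst.
under eq_fun do rewrite big_cons.
apply: (@L1cont_D (F k) (fun x => \sum_(k <- l) F k x)) => //.
exact: measurable_sum.
Qed.

(** Dynkin induction: on a rectangle the two sequences agree at all the
finitely many relevant coordinates from some rank on, and a disjoint union is
approximated by its finite subunions. *)
Lemma L1cont_indic (A : set (product_space R J)) : measurable A ->
  L1cont (\1_A : product_space R J -> R).
Proof.
rewrite measurable_rectanglesE; move: A; apply: (@dynkin_induction _ (product_space R J) (@rectangles R J)
  (fun A => L1cont (\1_A : product_space R J -> R)) (@measurable_rectanglesE R J)).
- exact: rectangles_setI.
- have -> : \1_setT = (fun=> 1) :> (product_space R J -> R).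
    by apply/funext => x; rewrite indicE in_setT.
  exact: L1cont_cst.
- move=> _ [l [A [ul mA ->]]] e e0.
  have : \forall n \near \oo, forall j, j \in l -> s n j = s0 j.
    elim: l {ul} => [|j l IH]; first exact: nearW.
    near=> n => i; rewrite inE => /orP[/eqP ->|].
      by near: n; exact: s_s0.
    by move: i; near: n; exact: IH.
  apply: filterS => n ln.
  rewrite integral0_eq ?lee_fin ?ltW// => w _.
  rewrite (_ : \1_(rectangle l A) (V n w) = \1_(rectangle l A) (V0 w) :> R) ?subrr ?normr0//.
  rewrite !indicE; congr ((nat_of_bool _)%:R).
  apply/idP/idP; rewrite !in_setE /= => h j jl; last first.
    by rewrite /V ln//; exact: h.
  by rewrite /V0 -ln//; exact: h.
- move=> A mA cA.
  have -> : \1_(~` A) = (fun x => 1 + (-1) * \1_A x) :> (product_space R J -> R).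
    by apply/funext => x; rewrite !indicE in_setC; case: (x \in A) => /=; rewrite ?mulr1 ?mulr0 ?addr0 ?subrr.
  apply: (@L1cont_D (fun=> 1) (fun x => (-1) * \1_A x)) => //.
  - by apply: measurable_funM => //; exact: measurable_indic.
  - exact: L1cont_cst.
  - by apply: (@L1cont_Z (-1) (\1_A)) => //; exact: measurable_indic.
- move=> A mA tA cA.
  apply: L1cont_limit.
    by apply: measurable_indic; exact: bigcupT_measurable.
  (* the tails decrease to the empty set, so their probability tends to 0 *)
  pose B m := \bigcup_(k in [set k | (m <= k)%N]) A k.
  have mB m : measurable (B m) by exact: bigcup_measurable.
  have Bcvg : P (V0 @^-1` B m) @[m --> \oo] --> P (\bigcap_m (V0 @^-1` B m)).
    apply: nonincreasing_cvg_mu.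
    - by rewrite (le_lt_trans (probability_le1 _ _)) ?ltry// -[X in measurable X]setTI; exact: mV0.
    - by move=> m; rewrite -[X in measurable X]setTI; exact: mV0.
    - apply: bigcapT_measurable => m.
      by rewrite -[X in measurable X]setTI; exact: mV0.
    - move=> m n mn; apply/subsetPset => w [k /= nk Ak].
      by exists k => //=; exact: leq_trans nk.
  have cap0 : \bigcap_m (V0 @^-1` B m) = set0.
    apply/seteqP; split => // w h.
    have [k _ Ak] := h 0%N Logic.I.
    have [k' /= kk' Ak'] := h k.+1 Logic.I.
    have := tA k k' Logic.I Logic.I; rewrite /= => /(_ (ex_intro _ _ (conj Ak Ak'))) kk.
    by rewrite kk ltnn in kk'.
  rewrite cap0 measure0 in Bcvg.
  move=> e e0.
  have [m _ /(_ m (leqnn m)) Pm] : \forall m \near \oo, (P (V0 @^-1` B m) <= e%:E)%E.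
    have : \forall m \near \oo, (P (V0 @^-1` B m) < e%:E)%E.
      exact: (Bcvg _ (@nbhs_open_ereal_lt R 0 (fun=> e) e0)).
    by apply: filterS => m /ltW.
  exists (fun x => \sum_(k <- iota 0 m) \1_(A k) x); split.
  - by apply: measurable_sum => k; exact: measurable_indic.
  - by apply: L1cont_sum => // k; exact: measurable_indic.
  apply: le_trans Pm.
  have mVB : measurable (V0 @^-1` B m).
    by rewrite -[X in measurable X]setTI; exact: mV0.
  have -> : P (V0 @^-1` B m) = (\int[P]_w (\1_(V0 @^-1` B m) w)%:E)%E.
    by rewrite integral_indic// setIT.
  have mG : measurable_fun setT
      (fun w => \1_(\bigcup_k A k) (V0 w) - \sum_(k <- iota 0 m) \1_(A k) (V0 w) : R).
    apply: measurable_funB.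
      apply: (@measurableT_comp _ _ _ _ _ _ (\1_(\bigcup_k A k) : _ -> R)) => //.
      by apply: measurable_indic; exact: bigcupT_measurable.
    apply: (@measurable_sum _ T R setT nat (iota 0 m)
      (fun k w => \1_(A k) (V0 w) : R)) => k.
    apply: (@measurableT_comp _ _ _ _ _ _ (\1_(A k) : _ -> R)) => //.
  apply: ge0_le_integral => //.
  - by apply/measurable_EFinP; exact: measurableT_comp.
  - by apply/measurable_EFinP; exact: measurable_indic.
  move=> w _; rewrite lee_fin.
  have [[k Ak]|none] := pselect (exists k, A k (V0 w)).
    have Aj j : \1_(A j) (V0 w) = (j == k)%:R :> R.
      rewrite indicE; have [->|jk] := eqVneq j k; first by rewrite mem_set.
      rewrite memNset// => Aj; move/eqP: jk; apply.
      by apply: tA => //; exists (V0 w).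
    under eq_bigr do rewrite Aj.
    rewrite indicE mem_set; last by exists k.
    have [km|mk] := ltnP k m.
      rewrite (bigD1_seq k) ?iota_uniq ?mem_iota//= eqxx big1 ?addr0 ?subrr ?normr0//.
      by move=> j /negbTE ->.
    rewrite big1_seq ?subr0 ?normr1; last first.
      move=> j /=; rewrite mem_iota add0n => jm.
      by rewrite ltn_eqF//; exact: leq_trans mk.
    by rewrite indicE mem_set//=; exists k.
  rewrite indicE memNset; last by move=> [k _ Ak]; apply: none; exists k.
  rewrite big1 ?subrr ?normr0// => j _.
  by rewrite indicE memNset// => Aj; apply: none; exists j.
Unshelve. all: try by end_near. Qed.

(** By approximation with simple functions. *)
Lemma L1cont_integrable (F : product_space R J -> R) :
  measurable_fun [set: product_space R J] F ->
  (\int[P]_w `|F (V0 w)|%:E < +oo)%E -> L1cont F.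
Proof.
move=> mF iF; apply: L1cont_limit => // e e0.
pose mu : {measure set (product_space R J) -> \bar R} := pushforward P V0.
have intF : (mu mV0).-integrable setT (EFin \o F).
  apply/integrableP; split; first exact/measurable_EFinP.
  rewrite ge0_integral_pushforward//.
  by apply/measurable_EFinP; exact: measurableT_comp.
have [G [iG _ FG]] := approximation_sfun_integrable measurableT intF.
have [n _ /(_ n (leqnn n)) Gn] : \forall n \near \oo,
    (\int[mu mV0]_x `|(EFin \o F) x - (G n x)%:E| <= e%:E)%E.
  have : \forall n \near \oo,
      (\int[mu mV0]_x `|(EFin \o F) x - (G n x)%:E| < e%:E)%E.
    exact: (FG _ (@nbhs_open_ereal_lt R 0 (fun=> e) e0)).
  by apply: filterS => m /ltW.
exists (G n); split => //.
- have -> : (G n : _ -> R) = (fun x =>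
      \sum_(y <- fset_set (range (G n))) y * \1_(G n @^-1` [set y]) x).
    by apply/funext => x; rewrite fimfunE fsbig_finite.
  apply: (@L1cont_sum R (fset_set (range (G n)))
      (fun y x => y * \1_(G n @^-1` [set y]) x)) => y.
    by apply: measurable_funM => //; exact: measurable_indic.
  apply: (@L1cont_Z y (\1_(G n @^-1` [set y]))).
    exact: measurable_indic.
  exact: L1cont_indic.
- move: Gn; rewrite ge0_integral_pushforward//.
  apply/measurable_EFinP; apply: measurableT_comp => //.
  exact: measurable_funB.
Qed.

(** A uniform bound on the L1 distance from [Z] to [F (V n)] passes to the
limit [F V0]. *)
Lemma integral_dist_limit_le (F : product_space R J -> R) (Z : T -> R) (c : \bar R) :
  measurable_fun [set: product_space R J] F ->
  measurable_fun setT Z ->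
  (\int[P]_w `|F (V0 w)|%:E < +oo)%E ->
  (forall n, \int[P]_w `|Z w - F (V n w)|%:E <= c)%E ->
  (\int[P]_w `|Z w - F (V0 w)|%:E <= c)%E.
Proof.
move=> mF mZ iF le_c; apply/lee_addgt0Pr => e e0.
have [n _ /(_ n (leqnn n)) ne] := L1cont_integrable mF iF e0.
apply: (le_trans (@le_integral_dist _ (fun w => F (V n w)) _ _ _ _)) => //.
- exact: measurableT_comp.
- exact: measurableT_comp.
- exact: leeD.
Qed.

End L1_continuity.

(** * Independent coupling of two sites of the field *)

Section sup_norm.
Variable d : nat.
Implicit Types x y : lattice d.

Lemma sup_normD x y : (sup_norm (x + y) <= sup_norm x + sup_norm y)%N.
Proof.
apply/bigmax_leqP => k _; rewrite mxE.
apply: (@leq_trans (`|x ord0 k| + `|y ord0 k|)%N).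
  by rewrite -lez_nat PoszD !abszE ler_normD.
by apply: leq_add; exact: (leq_bigmax k).
Qed.

Lemma sup_normN x : sup_norm (- x) = sup_norm x.
Proof. by apply: eq_bigr => k _; rewrite mxE abszN. Qed.

Lemma sup_norm_eq0 x : (sup_norm x == 0)%N = (x == 0).
Proof.
apply/eqP/eqP => [x0|->]; last first.
  by rewrite /sup_norm big1// => k _; rewrite mxE absz0.
apply/rowP => k; rewrite mxE; apply/eqP; rewrite -absz_eq0 -leqn0.
have : (`|x ord0 k| <= sup_norm x)%N by exact: (leq_bigmax k).
by rewrite x0.
Qed.

End sup_norm.

Section coupling.
Context {disp : measure_display} {T : measurableType disp} {R : realType}.
Variable P : probability T R.

Lemma le_L1_L2 (Z : T -> R) : measurable_fun setT Z ->
  (\int[P]_w `|Z w|%:E <= 'N[P]_2%:E[(fun w => (Z w)%:E)])%E.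
Proof.
move=> mZ; have := @hoelder _ _ _ P Z (cst 1) 2 2 mZ (measurable_cst _).
rewrite !ltr0n (_ : 2^-1 + 2^-1 = 1 :> R); last by field.
move=> /(_ isT isT erefl); rewrite Lnorm1.
have -> : ('N[P]_2%:E[EFin \o cst 1%R] = 1)%E.
  rewrite (_ : EFin \o cst 1%R = cst 1%E)//.
  rewrite Lnorm_cst1.
  have P1 := @probability_setT _ _ _ P.
  exact: (etrans (congr1 (fun x : \bar R => (x `^ 2^-1)%E) P1) (poweR1r _)).
rewrite mule1; apply: le_trans.
by under [leRHS]eq_integral do rewrite /= mulr1.
Qed.

Variables (d : nat) (g : (lattice d -> R) -> R).
Variables (eps eps' : lattice d -> {RV P >-> R}).
Hypotheses (heps : iid eps) (heps' : iid_copy eps eps').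
Hypothesis hg : measurable_fun [set: product_space R (lattice d)]
            (g : product_space R (lattice d) -> R).
Hypothesis hL1 : forall i, (\int[P]_w `|random_field g eps i w|%:E < +oo)%E.

Local Notation W := (join eps eps').
Let hW : iid W. Proof. exact: join_iid. Qed.

(** The field at site [i] recomputed with the innovations at the sites of [S]
replaced by their independent copies. *)
Definition resampled (S : lattice d -> bool) (i : lattice d) (w : T) : R :=
  g (fun s => W (i - s, S (i - s)) w).

Lemma measurable_resampled S i : measurable_fun setT (resampled S i).
Proof.
have mS : measurable_fun setT
    (fun w => (fun s => W (i - s, S (i - s)) w) : product_space R (lattice d)).
  exact: measurable_family.
exact: (measurableT_comp hg mS).
Qed.

(** The physical dependence coefficient of order 1. *)
Definition dep1 (i : lattice d) : \bar R := (\int[P]_w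
  `|random_field g eps i w - random_field g (coupled eps eps') i w|%:E)%E.

Lemma subrI_inj (i : lattice d) : injective (fun s => i - s).
Proof. by move=> s t /addrI /oppr_inj. Qed.

(** Replacing one more innovation, at site [k], moves the field at [i] by
[dep1 (i - k)] in mean, whatever has been replaced before: both sides are
integrals of the same function of an i.i.d. family indexed by the lattice and
one extra point, selected by two different injections. *)
Lemma resampled_flip (S S' : lattice d -> bool) (i k : lattice d) :
  S k = false -> S' k = true -> (forall l, l != k -> S l = S' l) ->
  (\int[P]_w `|resampled S i w - resampled S' i w|%:E = dep1 (i - k)%R)%E.
Proof.
move=> Sk S'k SS'.
(* the extra point [None] carries the copy of the innovation at [k]; [t] sends
   the site [k] to the origin *)
pose s (o : option (lattice d)) := if o is Some t then (i - t, S (i - t)) else (k, true).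
pose t (o : option (lattice d)) := if o is Some t then (i - k - t, false) else (0, true).
pose F (x : product_space R (option (lattice d))) : \bar R :=
  `|g (fun u => x (Some u)) - g (fun u => x (if u == i - k then None else Some u))|%:E.
have injs : injective s.
  move=> [u|] [v|]//=.
  - by move=> [/subrI_inj -> _].
  - by move=> [uk]; rewrite uk Sk.
  - by move=> [<-]; rewrite Sk.
have injt : injective t by move=> [u|] [v|]//= [/subrI_inj ->].
have mF : measurable_fun [set: product_space R (option (lattice d))] F.
  apply/measurable_EFinP; apply: measurableT_comp => //.
  by apply: measurable_funB; apply: (measurableT_comp hg);
    exact: measurable_reindex.
have -> : (\int[P]_w `|resampled S i w - resampled S' i w|%:E =
  \int[P]_w F (fun j => W (s j) w))%E.
  apply: eq_integral => w _; rewrite /F /resampled; congr (`|g _ - g _|%:E).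
  apply/funext => u; case: eqVneq => [->|uik] /=; rewrite ?subKr ?S'k//.
  by rewrite SS'//; apply: contra_neq uik => <-; rewrite subKr.
rewrite (integral_reindex hW injs injt mF)//; last by move=> x; rewrite /F.
apply: eq_integral => w _; rewrite /F /random_field; congr (`|g _ - g _|%:E).
apply/funext => u; case: eqVneq => [->|uik] /=; rewrite /coupled.
  by rewrite subrr eqxx.
by rewrite subr_eq0 eq_sym (negbTE uik).
Qed.

(** The sites of [S] among the first [N] ones, in the enumeration of the
lattice by [pickle]. *)
Definition truncate (S : lattice d -> bool) (N : nat) (k : lattice d) :=
  S k && (choice.pickle k < N)%N.

(** Replacing the innovations one at a time. *)
Lemma resampled_truncate_le S i N :
  (\int[P]_w `|random_field g eps i w - resampled (truncate S N) i w|%:E <=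
   \sum_(k <- [seq k <- pmap pickle_inv (iota 0 N) | S k]) dep1 (i - k)%R)%E.
Proof.
elim: N => [|N IH].
  rewrite (_ : truncate S 0 = fun=> false).
    by rewrite big_nil integral0_eq// => w _; rewrite subrr normr0.
  by apply/funext => k; rewrite /truncate ltn0 andbF.
rewrite -addn1 iotaD add0n pmap_cat filter_cat big_cat/=.
have tr k : (truncate S (N + 1) k) = truncate S N k || S k && (choice.pickle k == N).
  by rewrite /truncate addn1 ltnS leq_eqVlt orbC andb_orr.
case ek : (pickle_inv N) => [k|] /=; last first.
  rewrite big_nil adde0 (_ : truncate S (N + 1) = truncate S N)//.
  apply/funext => l; rewrite tr; have [lN|_] := eqVneq (choice.pickle l) N.
    by rewrite -lN pickleK_inv in ek.
  by rewrite andbF orbF.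
have kN : choice.pickle k = N by have := @choice.pickle_invK (matrix int 1 d) N; rewrite ek.
case: ifPn => Sk; last first.
  rewrite big_nil adde0 (_ : truncate S (N + 1) = truncate S N)//.
  apply/funext => l; rewrite tr; have [lN|_] := eqVneq (choice.pickle l) N.
    by rewrite -lN pickleK_inv in ek; case: ek => ->; rewrite (negbTE Sk) orbF.
  by rewrite andbF orbF.
rewrite big_seq1.
apply: (le_trans (@le_integral_dist _ _ _ P _
  (fun w => resampled (truncate S N) i w) _ _ _ _)).
- exact: (measurable_resampled (fun=> false)).
- exact: measurable_resampled.
- exact: measurable_resampled.
apply: leeD => //; rewrite (@resampled_flip _ _ _ k)//.
- by rewrite /truncate kN ltnn andbF.
- by rewrite tr kN eqxx Sk orbT.
- move=> l lk; rewrite tr; have [lN|_] := eqVneq (choice.pickle l) N.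
    by rewrite -lN pickleK_inv in ek; case: ek => lk'; rewrite lk' eqxx in lk.
  by rewrite andbF orbF.
Qed.

Variable p : R.
(** The weighted sum of the dependence coefficients. *)
Let S0 : \bar R := (\esum_(i in [set: lattice d]) (((sup_norm i)%:R `^ p)%:E * dep1 i))%E.

Lemma sum_dep1_le (S : lattice d -> bool) (i : lattice d) (N : nat) (r : R) : 0 < r -> 0 <= p ->
  (forall k, S k -> r <= (sup_norm (i - k))%:R) ->
  ((r `^ p)%:E * \sum_(k <- [seq k <- pmap pickle_inv (iota 0 N) | S k]) dep1 (i - k)%R
   <= S0)%E.
Proof.
move=> r0 p0 rS; set l := [seq k <- _ | S k].
have ul : uniq l.
  rewrite filter_uniq// (pmap_uniq (@pickle_invK _))//.
  exact: iota_uniq.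
have d0 k : (0 <= dep1 k)%E by exact: integral_ge0.
rewrite ge0_sume_distrr//.
apply: esum_ge; exists [set` map (fun k => i - k) l].
  by split => //; exact: finite_seq.
rewrite -fsbig_seq ?(map_inj_uniq (@subrI_inj i))// big_map.
rewrite big_seq [leRHS]big_seq; apply: lee_sum => k.
rewrite mem_filter => /andP[Sk _].
apply: lee_wpmul2r => //; rewrite lee_fin ge0_ler_powR//.
- by rewrite nnegrE ltW.
- by rewrite nnegrE.
- exact: rS.
Qed.

(** Replacing innovations only at distance at least [r] from [i] moves the
field at [i] by [O(r `^ (- p))] in mean. *)
Lemma resampled_dist (S : lattice d -> bool) (i : lattice d) (r : R) : 0 < r -> 0 <= p ->
  (forall k, S k -> r <= (sup_norm (i - k))%:R) ->
  ((r `^ p)%:E * \int[P]_w `|random_field g eps i w - resampled S i w|%:E <= S0)%E.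
Proof.
move=> r0 p0 rS.
have rp0 : 0 < r `^ p by rewrite powR_gt0.
rewrite muleC -lee_pdivlMr//.
apply: (@integral_dist_limit_le _ _ _ P _ _ W hW
  (fun N t => (i - t, truncate S N (i - t))) (fun t => (i - t, S (i - t))) _ _ _ g) => //.
- by move=> N u v [/subrI_inj].
- by move=> u v [/subrI_inj].
- move=> t; exists (choice.pickle (i - t)).+1 => // N /= tN.
  by rewrite /truncate tN andbT.
- exact: (measurable_resampled (fun=> false)).
- have -> : (\int[P]_w `|g (fun j => W (i - j, S (i - j)) w)|%:E =
     \int[P]_w `|g (fun j => W (i - j, false) w)|%:E)%E.
    apply: (integral_reindex hW (s := fun t => (i - t, S (i - t)))
      (t := fun t => (i - t, false)) (F := fun x => `|g x|%:E)) => //.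
    + by move=> u v [/subrI_inj].
    + by move=> u v [/subrI_inj].
    + by apply/measurable_EFinP; exact: measurableT_comp.
  exact: hL1.
- move=> N; rewrite lee_pdivlMr// muleC.
  apply: le_trans (sum_dep1_le N r0 p0 rS).
  by apply: lee_wpmul2l; [rewrite lee_fin ltW|exact: resampled_truncate_le].
Qed.

Lemma resampled_same_law (S : lattice d -> bool) (i : lattice d) (A : set R) :
  measurable A -> P (resampled S i @^-1` A) = P (random_field g eps i @^-1` A).
Proof.
move=> mA.
have mgA : measurable [set x : product_space R (lattice d) | A (g x)].
  by rewrite -[X in measurable X]setTI; exact: hg.
apply: (law_reindex hW (s := fun t => (i - t, S (i - t)))
  (t := fun t => (i - t, false)) _ _ mgA).
- by move=> u v [/subrI_inj].
- by move=> u v [/subrI_inj].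
Qed.

(** Independence of two random variables. *)
Definition indep_rv (X Y : T -> R) := forall A B, measurable A -> measurable B ->
  (P (X @^-1` A `&` Y @^-1` B) = P (X @^-1` A) * P (Y @^-1` B))%E.

(** The two variables are functions of disjoint parts of the joint family,
whose law is therefore that of two independent copies. *)
Lemma resampled_indep (S S' : lattice d -> bool) (i j : lattice d) :
  (forall k, S' k = ~~ S k) -> indep_rv (resampled S i) (resampled S' j).
Proof.
move=> SS' A B mA mB.
have mg C : measurable C -> measurable [set x : product_space R (lattice d) | C (g x)].
  by move=> mC; rewrite -[X in measurable X]setTI; exact: hg.
(* the two disjoint parts are moved to the innovations and to their copies *)
pose L := (lattice d + lattice d)%type.
pose s (o : L) := match o with inl t => (i - t, S (i - t)) | inr t => (j - t, S' (j - t)) end.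
pose t (o : L) := match o with inl t => (t, false) | inr t => (t, true) end.
have injs : injective s.
  move=> [u|u] [v|v] //=.
  - by move=> [/subrI_inj ->].
  - by move=> [->]; rewrite SS'; case: (S _).
  - by move=> [->]; rewrite SS'; case: (S _).
  - by move=> [/subrI_inj ->].
have injt : injective t by move=> [u|u] [v|v] //= [->].
have mC : measurable ([set x : product_space R L | A (g (fun u => x (inl u)))] `&`
                      [set x : product_space R L | B (g (fun u => x (inr u)))]).
  apply: measurableI.
    rewrite -[X in measurable X]setTI.
    apply: (measurableT_comp hg (@measurable_reindex R L (lattice d) inl)) => //.
  rewrite -[X in measurable X]setTI.
  apply: (measurableT_comp hg (@measurable_reindex R L (lattice d) inr)) => //.
have := law_reindex hW injs injt mC.
rewrite [LHS](_ : _ = P (resampled S i @^-1` A `&` resampled S' j @^-1` B))//.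
move=> ->; rewrite !resampled_same_law//.
have [_ _ hind] := heps'.
have := hind _ _ (mg _ mA) (mg _ mB).
rewrite [LHS](_ : _ = P [set w | ([set x | A (g (fun u : lattice d => x (inl u)))]
  `&` [set x | B (g (fun u : lattice d => x (inr u)))]) (fun j0 => W (t j0) w)])//.
move=> ->; congr (_ * _)%E.
  have := law_reindex hW (s := fun u => (u, false)) (t := fun t => (i - t, false)) _ _ (mg _ mA).
  apply; first by move=> u v [].
  by move=> u v [/subrI_inj].
have := law_reindex hW (s := fun u => (u, true)) (t := fun t => (j - t, false)) _ _ (mg _ mB).
apply; first by move=> u v [].
by move=> u v [/subrI_inj].
Qed.

(** Within the ball of centre [j] and radius half the distance from [i] to
[j], the copies are used for the first variable; outside it, for the second
one. So only sites at distance at least half of [sup_norm (i - j)] are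
replaced in either of them. *)
Lemma independent_coupling (i j : lattice d) : i != j -> 0 <= p ->
  exists X X' : T -> R,
    [/\ measurable_fun setT X /\ measurable_fun setT X',
        indep_rv X X',
        (forall A, measurable A -> P (X @^-1` A) = P (random_field g eps i @^-1` A)) /\
        (forall A, measurable A -> P (X' @^-1` A) = P (random_field g eps j @^-1` A)),
        ((((sup_norm (i - j))%:R / 2) `^ p)%:E *
           \int[P]_w `|random_field g eps i w - X w|%:E <= S0)%E &
        ((((sup_norm (i - j))%:R / 2) `^ p)%:E *
           \int[P]_w `|random_field g eps j w - X' w|%:E <= S0)%E].
Proof.
move=> ij p0; set r := sup_norm (i - j).
pose S k := (sup_norm (k - j) <= r./2)%N.
have r0 : 0 < (r%:R / 2 : R).
  by rewrite divr_gt0// ltr0n lt0n sup_norm_eq0 subr_eq0.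
have rE : r%:R = (odd r)%:R + (r./2)%:R * 2 :> R.
  by rewrite -natrM -natrD muln2 odd_double_half.
have odd1 : (odd r)%:R <= 1 :> R by case: odd.
have odd0 : 0 <= (odd r)%:R :> R by case: odd.
exists (resampled S i), (resampled (fun k => ~~ S k) j); split.
- by split; exact: measurable_resampled.
- exact: resampled_indep.
- by split => A mA; exact: resampled_same_law.
- apply: resampled_dist => // k Sk.
  have : (r <= sup_norm (i - k) + r./2)%N.
    rewrite {1}/r (_ : i - j = (i - k) + (k - j))%R; last by rewrite addrA subrK.
    by apply: (leq_trans (sup_normD _ _)); rewrite leq_add2l.
  rewrite -(ler_nat R) natrD => h.
  by lra.
- apply: resampled_dist => // k; rewrite /S -ltnNge -sup_normN opprB.
  by rewrite -(ler_nat R) -natr1 => h; lra.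
Qed.

End coupling.

(** * Summation of a power of the distance over the lattice *)

Section lattice_sum.
Context {R : realType}.

(** The tail of the series of [n `^ (- (1 + a))] is dominated by a telescoping
one. *)
Lemma powR_telescope (a : R) (n : nat) : 0 < a -> (0 < n)%N ->
  a * n.+1%:R `^ (- (1 + a)) <= n%:R `^ (- a) - n.+1%:R `^ (- a).
Proof.
move=> a0 n0.
have n10 : 0 < n.+1%:R :> R by rewrite ltr0n.
have n0' : 0 < n%:R :> R by rewrite ltr0n.
rewrite opprD powRD; last by apply/implyP => _; rewrite gt_eqF.
rewrite powR_inv1; last exact: ltW.
rewrite lerBrDr mulrA.
set q := n.+1%:R `^ (- a).
have q0 : 0 < q by rewrite powR_gt0.
rewrite (_ : n%:R `^ (- a) = q * expR (- a * ln (n%:R / n.+1%:R))); last first.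
  rewrite /q /powR !gt_eqF// -expRD lnM ?posrE ?invr_gt0// lnV ?posrE//.
  by congr expR; ring.
have : 1 + - a * ln (n%:R / n.+1%:R) <= expR (- a * ln (n%:R / n.+1%:R)).
  exact: expR_ge1Dx.
have : ln (n%:R / n.+1%:R : R) <= - n.+1%:R^-1.
  have := @le_ln1Dx R (- n.+1%:R^-1).
  rewrite (_ : 1 + - n.+1%:R^-1 = n%:R / n.+1%:R); last first.
    by rewrite -natr1; field; rewrite natr1 gt_eqF.
  apply.
  by rewrite ltrN2 invf_lt1// ltr1n ltnS.
move=> h1 h2.
have h3 : a * n.+1%:R^-1 <= - a * ln (n%:R / n.+1%:R).
  by rewrite mulNr -mulrN ler_pM2l// lerNr.
set y := expR _ in h2 *.
have h4 : 1 + a * n.+1%:R^-1 <= y by apply: le_trans h2; rewrite lerD2l.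
have := ler_wpM2l (ltW q0) h4; rewrite mulrDr mulr1.
rewrite (_ : q * (a * _) = a / n.+1%:R * q) 1?addrC//.
by rewrite mulrC.
Qed.

(** The weight [n `^ (- q)], with value 1 at [n = 0]. *)
Definition decay (q : R) (n : nat) : R := (maxn 1 n)%:R `^ (- q).

Lemma decay_ge0 q n : 0 <= decay q n. Proof. exact: powR_ge0. Qed.

Lemma sum_decay (a : R) (N : nat) : 0 < a ->
  \sum_(0 <= u < N) decay (1 + a) u <= 2 + a^-1.
Proof.
move=> a0.
have a1 : 0 < a^-1 by rewrite invr_gt0.
have key n : \sum_(0 <= u < n.+2) decay (1 + a) u <=
    2 + a^-1 * (1 - n.+1%:R `^ (- a)).
  elim: n => [|n IH].
    by rewrite !big_nat_recr//= big_geq// /decay/= !powR1; lra.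
  rewrite big_nat_recr//=; apply: (le_trans (lerD IH (lexx _))).
  have := @powR_telescope a n.+1 a0 (ltn0Sn _).
  rewrite -ler_pdivlMl// => h.
  have -> : decay (1 + a) n.+2 = n.+2%:R `^ (- (1 + a)) by [].
  lra.
case: N => [|[|n]].
- by rewrite big_geq//; lra.
- by rewrite big_nat1 /decay/= powR1; lra.
apply: (le_trans (key n)).
have : a^-1 * (n.+1%:R `^ (- a)) >= 0 by rewrite mulr_ge0 ?powR_ge0// ltW.
lra.
Qed.

Lemma sum_decay_dist (a : R) (N : nat) : 0 < a ->
  \sum_(t < N.*2.+1) decay (1 + a) (`|(t : nat)%:Z - N%:Z|)%N <= 2 * (2 + a^-1).
Proof.
move=> a0.
rewrite -(big_mkord xpredT (fun t : nat => decay (1 + a) (`|t%:Z - N%:Z|)%N)).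
rewrite (@big_cat_nat _ _ _ N)//=; last by rewrite -addnn -addnS leq_addr.
rewrite mulr_natl mulr2n; apply: lerD.
  apply: le_trans (@sum_decay a N.+1 a0).
  rewrite big_nat_rev/= add0n big_nat_recl//=.
  apply: (@le_trans _ _ (\sum_(0 <= i < N) decay (1 + a) i.+1)); last first.
    by rewrite lerDr decay_ge0.
  rewrite big_nat [leRHS]big_nat; apply: ler_sum => i /andP[_ iN].
  rewrite (_ : `|_|%N = i.+1)//; lia.
rewrite -{1}(add0n N) big_addn.
rewrite (_ : (N.*2.+1 - N)%N = N.+1); last by rewrite -addnn -addnS addKn.
apply: le_trans (@sum_decay a N.+1 a0).
apply: ler_sum => i _.
by rewrite (_ : `|_|%N = i)// PoszD addrK.
Qed.

(** Since [sup_norm] dominates each of the [d] coordinates, the summand is at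
most a product over the coordinates of terms [decay (1 + a)], and the sum over
a box factorises. *)
Lemma lattice_sum (d : nat) (a : R) (i : lattice d) (F : seq (lattice d)) :
  (0 < d)%N -> 0 < a -> uniq F ->
  \sum_(j <- F | i != j) (sup_norm (i - j))%:R `^ (- (d%:R * (1 + a))) <=
    (2 * (2 + a^-1)) ^+ d.
Proof.
move=> d0 a0 uF.
pose y : R := \sum_(j <- F) \prod_(k < d) decay (1 + a) `|(i - j)%R ord0 k|%N.
apply: (@le_trans _ _ y).
  rewrite /y big_mkcond/=; apply: ler_sum => j _.
  case: ifPn => ij; last by apply: prodr_ge0 => k _; exact: decay_ge0.
  have r0 : (0 < sup_norm (i - j))%N by rewrite lt0n sup_norm_eq0 subr_eq0.
  rewrite -mulrN mulrC powRrM powR_mulrn ?powR_ge0//.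
  rewrite -[X in _ ^+ X]card_ord -prodr_const.
  apply: ler_prod => k _; rewrite powR_ge0/= /decay !powRN.
  rewrite lef_pV2 ?posrE ?powR_gt0 ?ltr0n ?leq_max//.
  rewrite ge0_ler_powR ?nnegrE//; first by lra.
  by rewrite ler_nat geq_max r0/=; exact: (leq_bigmax k).
pose N := (\max_(j <- F) sup_norm (i - j))%N.
(* [i - j] shifted into the box of side [N.*2.+1] *)
pose G (j : lattice d) : {ffun 'I_d -> 'I_(N.*2.+1)} :=
  [ffun k => inord (absz ((i - j)%R ord0 k + N%:Z))].
have GE j k : j \in F -> ((G j k : nat)%:Z = (i - j)%R ord0 k + N%:Z)%R.
  move=> jF; rewrite ffunE.
  have : (`|(i - j)%R ord0 k| <= N)%N.
    apply: (@leq_trans (sup_norm (i - j))); first exact: (leq_bigmax k).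
    exact: leq_bigmax_seq.
  move=> h; rewrite inordK; lia.
have -> : y =
    \sum_(f <- map G F) \prod_(k < d) decay (1 + a) `|(f k : nat)%:Z - N%:Z|%N.
  rewrite /y big_map big_seq [RHS]big_seq; apply: eq_bigr => j jF.
  by apply: eq_bigr => k _; rewrite GE// addrK.
have uG : uniq (map G F).
  rewrite map_inj_in_uniq// => j j' jF j'F /ffunP h.
  apply/rowP => k; have := congr1 (fun t : 'I_(N.*2.+1) => (t : nat)%:Z) (h k).
  by rewrite !GE// => /addIr; rewrite !mxE => /addrI /oppr_inj.
rewrite big_uniq//=.
apply: (@le_trans _ _ (\sum_(f : {ffun 'I_d -> 'I_(N.*2.+1)})
   \prod_(k < d) decay (1 + a) `|(f k : nat)%:Z - N%:Z|%N)).
  rewrite big_mkcond/=; apply: ler_sum => f _; case: ifP => // _.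
  by apply: prodr_ge0 => k _; exact: decay_ge0.
rewrite -(bigA_distr_bigA (fun (k : 'I_d) (t : 'I_(N.*2.+1)) =>
  decay (1 + a) `|(t : nat)%:Z - N%:Z|%N)).
rewrite -[leRHS](_ : \prod_(k < d) (2 * (2 + a^-1)) = _); last first.
  by rewrite prodr_const card_ord.
apply: ler_prod => k _; rewrite sum_decay_dist// andbT.
by apply: sumr_ge0 => t _; exact: decay_ge0.
Qed.

End lattice_sum.

(** * Negative powers of the distance to a point, and interpolation *)

Section inverse_power.
Context {R : realType}.
Local Notation mu := (@lebesgue_measure R).

Lemma powR_cont (p x : R) : 0 < x -> y `^ p @[y --> x] --> x `^ p.
Proof.
move=> x0; have [+ _] := @is_derive1_powR R p x x0.
by move=> /derivable1_diffP/differentiable_continuous; exact.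
Qed.

Lemma integral_inv_powR_itv (e : R) : 0 < e -> e < 1 ->
  (\int[mu]_(x in `[e, 1%R]) (x `^ (- (3 / 4)))%:E <= 4%:E)%E.
Proof.
move=> e0 e1.
rewrite (@continuous_FTC2 R (fun x : R => x `^ (- (3 / 4))) (fun x => 4 * x `^ (1 / 4)))//.
- rewrite powR1 mulr1 -EFinB lee_fin lerBlDr lerDl.
  by rewrite mulr_ge0 ?powR_ge0.
- apply: continuous_in_subspaceT => x; rewrite inE/= in_itv/= => /andP[ex _].
  by apply: powR_cont; exact: lt_le_trans ex.
- split => [x||].
  + rewrite in_itv/= => /andP[ex _]; apply: derivableM => //.
    have := @is_derive1_powR R (1 / 4) x (lt_trans e0 ex) => -[]//.
  + apply: cvg_at_right_filter; apply: cvgM; first exact: cvg_cst.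
    exact: powR_cont.
  + apply: cvg_at_left_filter; apply: cvgM; first exact: cvg_cst.
    exact: powR_cont.
- move=> x; rewrite in_itv/= => /andP[ex _].
  have x0 := lt_trans e0 ex.
  have h := @is_derive1_powR R (1 / 4) x x0.
  rewrite derive1E deriveM//.
  rewrite derive_val derive_cst scaler0 addr0.
  rewrite (_ : 1 / 4 - 1 = - (3 / 4)) ?(_ : _ *: _ = _)//; last by lra.
  by rewrite /GRing.scale/= mulrA; lra.
Qed.

(** The function [v `^ (- (3 / 4))] on the interval from 0 (excluded) to 1,
and 0 elsewhere. *)
Definition inv_pow01 (v : R) : R := \1_(`]0%R, 1%R]%classic) v * v `^ (- (3 / 4)).

Lemma inv_pow01_ge0 v : 0 <= inv_pow01 v.
Proof. by rewrite mulr_ge0 ?powR_ge0. Qed.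

Lemma measurable_inv_pow01 : measurable_fun setT inv_pow01.
Proof.
apply: measurable_funM; first exact: measurable_indic.
exact: measurable_powR.
Qed.

Lemma integral_inv_pow01 : (\int[mu]_v (inv_pow01 v)%:E <= 4%:E)%E.
Proof.
pose F n : set R := `[(n.+2%:R^-1)%R, 1%R]%classic.
have -> : (\int[mu]_v (inv_pow01 v)%:E =
    \int[mu]_(v in \bigcup_n F n) (v `^ (- (3 / 4)))%:E)%E.
  rewrite [RHS]integral_mkcond; apply: eq_integral => v _.
  rewrite patchE /inv_pow01 indicE (_ : (v \in `]0, 1]%classic) = (v \in \bigcup_n F n)).
    by case: ifP => _; rewrite ?mul1r ?mul0r.
  apply/idP/idP; rewrite !inE /F/= in_itv/=.
    move=> /andP[v0 v1]; exists (Num.truncn v^-1) => //=.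
    rewrite in_itv/= v1 andbT invf_ple ?posrE//.
    by apply: (le_trans (ltW (truncnS_gt _))); rewrite ler_nat ltnS leqnSn.
  move=> [n _] /=; rewrite in_itv/= => /andP[nv ->]; rewrite andbT.
  by apply: lt_le_trans nv; rewrite invr_gt0.
have cv := @ge0_nondecreasing_set_cvg_integral _ (measurableTypeR R) R F
  (fun v => (v `^ (- (3 / 4)))%:E) mu.
have ndF : nondecreasing_seq F.
  move=> m n mn; apply/subsetPset => x; rewrite /F/= !in_itv/= => /andP[mx ->].
  rewrite andbT; apply: le_trans mx.
  by rewrite lef_pV2 ?posrE ?ltr0n// ler_nat.
have mF n : measurable (F n : set (measurableTypeR R)) by exact: measurable_itv.
have mp n : measurable_fun (F n) (fun v : measurableTypeR R => (v `^ (- (3 / 4)))%:E).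
  by apply/measurable_EFinP/measurable_funTS; exact: measurable_powR.
have p0 n (x : measurableTypeR R) : F n x -> (0 <= (x `^ (- (3 / 4)))%:E)%E.
  by rewrite lee_fin powR_ge0.
rewrite -(cvg_lim _ (cv ndF mF mp p0))//.
apply: lime_le; first by apply/cvg_ex; eexists; exact: cv.
apply: nearW => n; apply: integral_inv_powR_itv; first by rewrite invr_gt0 ltr0n.
by rewrite invf_lt1 ?ltr1n ?ltr0n.
Qed.

Lemma abs_powR_le (v : R) : `|v| `^ (- (3 / 4)) <= 1 + inv_pow01 v + inv_pow01 (- v).
Proof.
have n0 := inv_pow01_ge0.
have [->|v0] := eqVneq v 0.
  rewrite normr0 powR0; last by rewrite lt_eqF//; lra.
  by have := n0 0; have := n0 (- 0); lra.
have vp : 0 < `|v| by rewrite normr_gt0.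
have [v1|v1] := leP `|v| 1; last first.
  have : `|v| `^ (- (3 / 4)) <= 1.
    rewrite powRN invf_le1 ?powR_gt0//.
    have : 1 `^ (3 / 4) <= `|v| `^ (3 / 4) by apply: ge0_ler_powR; rewrite ?nnegrE ?ltW// ltr0n.
    by rewrite powR1.
  by have := n0 v; have := n0 (- v); lra.
have : inv_pow01 `|v| = `|v| `^ (- (3 / 4)).
  by rewrite /inv_pow01 indicE mem_set ?mul1r//= in_itv/= vp.
case: (ger0P v) => _ <-; have := n0 v; have := n0 (- v); lra.
Qed.

(** Near [s] the negative power has integral at most 4 on each side and the
density is at most [M]; far from [s] the power is at most 1 and the density
has integral 1. *)
Lemma integral_abs_powR_density (f : R -> R) (M : R) (s : R) :
  measurable_fun setT f -> (forall x, 0 <= f x) -> (forall x, f x <= M) ->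
  (\int[mu]_x (f x)%:E = 1)%E ->
  (\int[mu]_t ((`|s - t| `^ (- (3 / 4)))%:E * (f t)%:E) <= (1 + 8 * M)%:E)%E.
Proof.
move=> mf f0 fM f1.
have M0 : 0 <= M by apply: le_trans (f0 0) (fM 0).
have mk := measurable_inv_pow01.
have mks : measurable_fun setT (fun t : R => inv_pow01 (s - t)).
  by apply: (measurableT_comp mk); exact: measurable_funB.
have mks' : measurable_fun setT (fun t : R => inv_pow01 (t - s)).
  by apply: (measurableT_comp mk); exact: measurable_funB.
apply: (@le_trans _ _ (\int[mu]_t ((f t)%:E + (M%:E * (inv_pow01 (s - t))%:E +
    M%:E * (inv_pow01 (t - s))%:E)))%E).
  apply: ge0_le_integral => //.
  - by move=> t _; rewrite mule_ge0 ?lee_fin ?powR_ge0.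
  - apply: emeasurable_funM; apply/measurable_EFinP => //.
    apply: (measurableT_comp (measurable_powR _)).
    by apply: measurableT_comp => //; exact: measurable_funB.
  - apply: emeasurable_funD; first exact/measurable_EFinP.
    by apply: emeasurable_funD; apply/measurable_EFinP; exact: measurable_funM.
  - move=> t _; rewrite -!EFinM -!EFinD lee_fin.
    have := abs_powR_le (s - t); rewrite opprB => h.
    apply: (le_trans (ler_wpM2r (f0 t) h)).
    rewrite !mulrDl mul1r -addrA lerD2l.
    by apply: lerD; rewrite mulrC ler_wpM2r// inv_pow01_ge0.
have n0 v : (0 <= (inv_pow01 v)%:E)%E by rewrite lee_fin inv_pow01_ge0.
have M0' : (0 <= M%:E)%E by rewrite lee_fin.
rewrite ge0_integralD//; last 4 first.
- by move=> t _; rewrite lee_fin.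
- exact/measurable_EFinP.
- by move=> t _; rewrite adde_ge0// mule_ge0.
- by apply: emeasurable_funD; apply/measurable_EFinP; exact: measurable_funM.
rewrite ge0_integralD//; last 4 first.
- by move=> t _; rewrite mule_ge0.
- by apply/measurable_EFinP; exact: measurable_funM.
- by move=> t _; rewrite mule_ge0.
- by apply/measurable_EFinP; exact: measurable_funM.
rewrite f1 !ge0_integralZl//; last 2 first.
- exact/measurable_EFinP.
- exact/measurable_EFinP.
have mEk : measurable_fun setT (fun v : R => (inv_pow01 v)%:E) by exact/measurable_EFinP.
rewrite (ge0_integral_reflect s mEk n0).
have -> : (\int[mu]_t (inv_pow01 (t - s))%:E = \int[mu]_v (inv_pow01 v)%:E)%E.
  rewrite -[RHS]mul1e -[X in (X%:E * _)%E]invr1.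
  rewrite -(ge0_integral_affine (- s) ltr01 mEk n0).
  by apply: eq_integral => t _; rewrite mul1r.
rewrite (_ : (1 + 8 * M) = 1 + (M * 4 + M * 4)); last by lra.
rewrite !EFinD; apply: leeD => //; rewrite !EFinM; apply: leeD; apply: lee_wpmul2l => //;
  exact: integral_inv_pow01.
Qed.

(** A bound [a <= M] and a bound on [a ^+ 2 * v] combine into one that is
linear in [w], with an arbitrary scale [D], at the price of an integrable
power of [v]. *)
Lemma young_interpolation (a M w v D : R) : 0 < D -> 0 < v -> 0 <= w -> 0 <= a ->
  0 < M -> a <= M -> a ^+ 2 * v <= M ^+ 2 * w ->
  a <= M * D `^ (3 / 7) * (w / D + v `^ (- (3 / 4))).
Proof.
move=> D0 v0 w0 a0 M0 aM aw.
have [->|an0] := eqVneq a 0.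
  apply: mulr_ge0; first by apply: mulr_ge0; [exact: ltW|exact: powR_ge0].
  by apply: addr_ge0; [apply: divr_ge0 => //; exact: ltW|exact: powR_ge0].
have ap : 0 < a by rewrite lt_neqAle eq_sym an0.
set x := w / D; set y := v `^ _; set z := x + y.
have y0 : 0 < y by rewrite powR_gt0.
have x0 : 0 <= x by rewrite divr_ge0// ltW.
have z0 : 0 < z by rewrite ltr_wpDl.
pose c := a / M.
have c0 : 0 < c by rewrite divr_gt0.
have c1 : c <= 1 by rewrite ler_pdivrMr// mul1r.
rewrite -mulrA mulrC -ler_pdivrMr// -/c.
have cw : c ^+ 2 <= w / v.
  by rewrite ler_pdivlMr// expr_div_n mulrAC ler_pdivrMr ?exprn_gt0// [leRHS]mulrC.
(* [c ^+ 2 <= w / v = D * x * y `^ (4 / 3)], and [x], [y] are at most [z] *)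
have cD : c `^ (7 / 3) <= D * z `^ (7 / 3).
  apply: (@le_trans _ _ (c ^+ 2)).
    rewrite -powR_mulrn; last exact: ltW.
    by apply: ger_powR; [rewrite c0 c1|lra].
  apply: (le_trans cw).
  have yE : y `^ (4 / 3) = v^-1.
    rewrite /y -powRrM (_ : - (3 / 4) * (4 / 3) = -1); last by field.
    by rewrite powR_inv1// ltW.
  rewrite (_ : w / v = D * (x * y `^ (4 / 3))); last first.
    by rewrite yE /x; field; rewrite !gt_eqF.
  rewrite ler_pM2l// (_ : 7 / 3 = 1 + 4 / 3); last by field.
  rewrite powRD; last by apply/implyP => _; rewrite gt_eqF.
  rewrite (powRr1 (ltW z0)); apply: ler_pM => //.
  - exact: powR_ge0.
  - by rewrite lerDl ltW.
  - apply: ge0_ler_powR; rewrite ?nnegrE; [lra|exact: ltW|exact: ltW|].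
    by rewrite lerDr.
have z1 : 0 <= z `^ (7 / 3) by exact: powR_ge0.
have := @ge0_ler_powR R (3 / 7) _ (c `^ (7 / 3)) (D * z `^ (7 / 3)).
rewrite powRM//; last exact: ltW.
rewrite -!powRrM (_ : 7 / 3 * (3 / 7) = 1); last by field.
rewrite (powRr1 (ltW c0)) (powRr1 (ltW z0)); apply => //.
- by rewrite nnegrE powR_ge0.
- by rewrite nnegrE mulr_ge0// ltW.
Qed.

End inverse_power.

(** * The autocorrelation of the kernel *)

Section Rintegral_bound.
Context d (T : measurableType d) (R : realType).
Variable mu : {measure set T -> \bar R}.

Lemma EFin_Rintegral (f : T -> R) : mu.-integrable setT (EFin \o f) ->
  ((\int[mu]_x f x)%R%:E = \int[mu]_x (f x)%:E)%E.
Proof. by move=> intf; rewrite /Rintegral fineK//; exact: integrable_fin_num. Qed.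

Lemma Rintegral_abs_le (f : T -> R) (c : R) :
  measurable_fun setT f -> (\int[mu]_x `|f x|%:E <= c%:E)%E ->
  `|(\int[mu]_x f x)%R| <= c.
Proof.
move=> mf fc.
have intf : mu.-integrable setT (EFin \o f).
  apply/integrableP; split; first exact/measurable_EFinP.
  by apply: le_lt_trans fc _; rewrite ltry.
rewrite -lee_fin; apply: le_trans fc.
rewrite EFin_normr_Rintegral//.
apply: le_abse_integral => //.
by case/integrableP: intf.
Qed.

Lemma integrable_bounded_by (f : T -> R) (c : R) :
  measurable_fun setT f -> (\int[mu]_x `|f x|%:E <= c%:E)%E ->
  mu.-integrable setT (EFin \o f).
Proof.
move=> mf fc; apply/integrableP; split; first exact/measurable_EFinP.
by apply: le_lt_trans fc _; rewrite ltry.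
Qed.

End Rintegral_bound.

Section signed_change.
Context {R : realType}.
Local Notation mu := (@lebesgue_measure R).

(** A change of variables that is known for nonnegative functions holds for
integrable ones. *)
Lemma signed_change (tau : R -> R) (c : R) (f : R -> R) :
  (forall phi : R -> \bar R, measurable_fun setT phi ->
    (forall x, 0 <= phi x)%E ->
    \int[mu]_x phi (tau x) = c%:E * \int[mu]_x phi x)%E ->
  mu.-integrable setT (EFin \o f) ->
  ((\int[mu]_x f (tau x)) = c * \int[mu]_x f x)%R.
Proof.
move=> H intf.
have mf : measurable_fun setT (EFin \o f) by case/integrableP: intf.
rewrite /Rintegral -[X in X * _]/(fine c%:E) -fineM//; last exact: integrable_fin_num.
congr fine.
rewrite [LHS]integralE [X in (_ * X)%E]integralE muleBr//; last first.
  apply: fin_num_adde_defl; rewrite fin_numN.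
  exact: integrable_fin_num (integrable_funeneg _ intf).
rewrite -!H; [|exact: measurable_funeneg|by []|exact: measurable_funepos|by []].
congr (_ - _)%E; apply: eq_integral => x _.
  by rewrite !funeposE.
by rewrite !funenegE.
Qed.

End signed_change.

Section autocorrelation.
Context {R : realType}.
Local Notation mu := (@lebesgue_measure R).
Variables (K : R -> R) (M L k0 k1 : R).
Hypotheses (mK : measurable_fun setT K) (KM : forall x, `|K x| <= M).
Hypotheses (K0 : (\int[mu]_v `|K v|%:E <= k0%:E)%E)
  (K1 : (\int[mu]_v (`|v| * `|K v|)%:E <= k1%:E)%E)
  (KL : forall x y, `|K x - K y| <= L * `|x - y|).

Let M0 : 0 <= M. Proof. by apply: le_trans (KM 0). Qed.

Let L0 : 0 <= L.
Proof. by have := KL 1 0; rewrite subr0 normr1 mulr1; apply: le_trans. Qed.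

Let k00 : 0 <= k0.
Proof. by rewrite -lee_fin; apply: le_trans K0; exact: integral_ge0. Qed.

Let k10 : 0 <= k1.
Proof.
by rewrite -lee_fin; apply: le_trans K1; apply: integral_ge0 => x _; rewrite lee_fin mulr_ge0.
Qed.

(** The autocorrelation of the kernel. *)
Definition autocorr (u : R) : R := (\int[mu]_v (K v * K (v + u)))%R.

Lemma measurable_shift (u : R) : measurable_fun setT (fun v : R => K (v + u)).
Proof. by apply: (measurableT_comp mK); exact: measurable_funD. Qed.

Let mKK (u : R) : measurable_fun setT (fun v : R => K v * K (v + u)).
Proof. by apply: measurable_funM => //; exact: measurable_shift. Qed.

Let int_le (F G : R -> R) (c : R) : measurable_fun setT F -> measurable_fun setT G ->
  0 <= c ->
  (forall v, `|F v| <= c * G v) -> (forall v, 0 <= G v) ->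
  (\int[mu]_v `|F v|%:E <= c%:E * \int[mu]_v (G v)%:E)%E.
Proof.
move=> mF mG c0 FG G0.
rewrite -ge0_integralZl//; last 2 first.
- exact/measurable_EFinP.
- by move=> v _; rewrite lee_fin.
apply: ge0_le_integral => //.
- by apply/measurable_EFinP; exact: measurableT_comp.
- by apply/measurable_EFinP; exact: measurable_funM.
- by move=> v _; rewrite -EFinM lee_fin.
Qed.

Let mnK : measurable_fun setT (fun v => `|K v|).
Proof. exact: measurableT_comp. Qed.

Let KK_le (u : R) : (\int[mu]_v `|K v * K (v + u)|%:E <= (M * k0)%:E)%E.
Proof.
apply: le_trans (@int_le _ (fun v => `|K v|) M (mKK u) mnK M0 _ _) _ => //.
- by move=> v; rewrite normrM mulrC ler_wpM2r.
- by rewrite EFinM lee_wpmul2l// lee_fin.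
Qed.

Lemma integrable_KK (u : R) : mu.-integrable setT (EFin \o (fun v => K v * K (v + u))).
Proof.
apply: (@integrable_bounded_by _ (measurableTypeR R) R mu (fun v => K v * K (v + u)) (M * k0)).
  exact: mKK.
exact: KK_le.
Qed.

Lemma autocorr_bounded u : `|autocorr u| <= M * k0.
Proof.
apply: (@Rintegral_abs_le _ (measurableTypeR R) R mu (fun v => K v * K (v + u))).
  exact: mKK.
exact: KK_le.
Qed.

Lemma autocorr_lipschitz u u' : `|autocorr u - autocorr u'| <= L * k0 * `|u - u'|.
Proof.
rewrite /autocorr -RintegralB//; [|exact: integrable_KK|exact: integrable_KK].
have mB : measurable_fun setT (fun v : R => K v * K (v + u) - K v * K (v + u')).
  exact: measurable_funB.
apply: (@Rintegral_abs_le _ (measurableTypeR R) R mu _ _ mB).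
apply: le_trans (@int_le _ (fun v => `|K v|) (L * `|u - u'|) mB mnK _ _ _) _ => //.
- by rewrite mulr_ge0.
- move=> v; rewrite -mulrBr normrM mulrC ler_wpM2r//.
  by apply: (le_trans (KL _ _)); rewrite opprD addrACA subrr add0r.
- rewrite [in leRHS](_ : L * k0 * _ = L * `|u - u'| * k0); last by ring.
  rewrite [leRHS]EFinM.
  by apply: lee_wpmul2l => //; rewrite lee_fin mulr_ge0.
Qed.

(** From [`|u| <= `|v| + `|v + u|] under the integral. *)
Lemma autocorr_decay u : `|u| * `|autocorr u| <= 2 * M * k1.
Proof.
rewrite -[X in X * _]normr_id -normrM -RintegralZl//; last exact: integrable_KK.
have mB : measurable_fun setT (fun v : R => `|u| * (K v * K (v + u))).
  exact: measurable_funM.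
apply: (@Rintegral_abs_le _ (measurableTypeR R) R mu _ _ mB).
have mvK : measurable_fun setT (fun v : R => `|v| * `|K v|).
  by apply: measurable_funM => //; exact: measurableT_comp.
have mvKu : measurable_fun setT (fun v : R => `|v + u| * `|K (v + u)|).
  by apply: (measurableT_comp mvK); exact: measurable_funD.
apply: le_trans (@int_le _ (fun v => `|v| * `|K v| + `|v + u| * `|K (v + u)|) M mB _ _ _ _) _ => //.
- exact: measurable_funD.
- move=> v; rewrite !normrM normr_id.
  have uv : `|u| <= `|v| + `|v + u|.
    rewrite [X in `|X| <= _](_ : u = - v + (v + u)); last by rewrite addKr.
    by apply: (le_trans (ler_normD _ _)); rewrite normrN.
  apply: (le_trans (ler_wpM2r _ uv)); first by rewrite mulr_ge0.
  rewrite mulrDl mulrDr; apply: lerD.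
    by rewrite mulrA mulrC ler_wpM2r ?mulr_ge0.
  by rewrite [leLHS]mulrCA ler_wpM2r ?mulr_ge0.
- rewrite -mulrA (_ : 2 * (M * k1) = M * (k1 + k1)); last by ring.
  rewrite [leRHS]EFinM; apply: lee_wpmul2l; first by rewrite lee_fin.
  under eq_integral do rewrite EFinD.
  have nn (v : R) : (0 <= (`|v| * `|K v|)%:E)%E by rewrite lee_fin mulr_ge0.
  rewrite ge0_integralD//; last 2 first.
  - exact/measurable_EFinP.
  - exact/measurable_EFinP.
  rewrite EFinD; apply: leeD => //.
  have mE : measurable_fun setT (fun v : R => (`|v| * `|K v|)%:E) by exact/measurable_EFinP.
  rewrite [leLHS](_ : _ = \int[mu]_v (`|v| * `|K v|)%:E)%E//.
  rewrite -[RHS]mul1e -[X in (X%:E * _)%E]invr1.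
  rewrite -(ge0_integral_affine u ltr01 mE nn).
  by apply: eq_integral => t _; rewrite mul1r.
Qed.

(** One side is linear in the length of [u'], the other one in that of [u -
u']: a common rescaling of the two lengths cancels out. *)
Lemma autocorr_sqr u u' : (autocorr u - autocorr u') ^+ 2 * `|u'| <=
  (6 * L * k0 * M * k1 + 8 * (M * k0) ^+ 2) * `|u - u'|.
Proof.
set w : R := `|u - u'|; set a := autocorr u; set a' := autocorr u'.
have w0 : 0 <= w by exact: normr_ge0.
have hb := autocorr_bounded u; have hb' := autocorr_bounded u'.
have hl := autocorr_lipschitz u u'.
have hd := autocorr_decay u; have hd' := autocorr_decay u'.
rewrite -/a -/a' -/w in hb hb' hl hd hd'.
have hsub : `|a - a'| <= `|a| + `|a'| by apply: ler_normB.
have htri : `|u'| <= `|u| + w.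
  rewrite [X in `|X| <= _](_ : u' = u - (u - u')); last by rewrite subKr.
  exact: ler_normB.
have [w2|w2] := leP w (`|u'| / 2).
  (* [u] and [u'] are comparable: one factor is bounded by the Lipschitz
     property, the other one by the decay at infinity *)
  have h2 : `|a - a'| * `|u'| <= 6 * M * k1.
    apply: (@le_trans _ _ (`|a| * `|u'| + `|a'| * `|u'|)).
      by rewrite -mulrDl ler_wpM2r.
    have : `|a| * `|u'| <= `|a| * (2 * `|u|) by apply: ler_wpM2l => //; lra.
    lra.
  have -> : (a - a') ^+ 2 = `|a - a'| * `|a - a'|.
    by rewrite -normrM -expr2 ger0_norm ?sqr_ge0.
  rewrite -[leLHS]mulrA; apply: (@le_trans _ _ (L * k0 * w * (6 * M * k1))).
    by apply: ler_pM; rewrite ?mulr_ge0.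
  have : 0 <= 8 * (M * k0) ^+ 2 * w by rewrite mulr_ge0// mulr_ge0// sqr_ge0.
  lra.
(* [`|u'| < 2 * w]: boundedness alone suffices *)
have : (a - a') ^+ 2 <= 4 * (M * k0) ^+ 2.
  have : `|a - a'| <= 2 * (M * k0) by lra.
  rewrite (_ : 4 * (M * k0) ^+ 2 = (2 * (M * k0)) ^+ 2); last by ring.
  by move=> h; rewrite -[X in X <= _]ger0_norm ?sqr_ge0// normrX lerXn2r// nnegrE (le_trans _ h).
move=> h; apply: (@le_trans _ _ (4 * (M * k0) ^+ 2 * (2 * w))).
  by apply: ler_pM => //; [exact: sqr_ge0|lra].
have : 0 <= 6 * L * k0 * M * k1 * w by rewrite !mulr_ge0.
lra.
Qed.

(** The substitution [v = (x - s) / b]. *)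
Lemma autocorr_scale (b s t : R) : 0 < b ->
  (\int[mu]_x (K ((x - s) / b) * K ((x - t) / b)) = b * autocorr ((s - t) / b))%R.
Proof.
move=> b0.
have bi0 : 0 < b^-1 by rewrite invr_gt0.
have := @signed_change R (fun x => b^-1 * x + (- s / b)) b
  (fun v => K v * K (v + (s - t) / b)) _ (integrable_KK _).
move=> <-; last first.
  by move=> phi mphi phi0; rewrite ge0_integral_affine// invrK.
apply: eq_Rintegral => x _; congr (K _ * K _); by field; rewrite gt_eqF.
Qed.

End autocorrelation.

(** * Integrals over an independent pair *)

Section independent_pair.
Context {disp : measure_display} {T : measurableType disp} {R : realType}.
Variable P : probability T R.

Lemma integrable_bounded (F : T -> R) (M : R) : measurable_fun setT F ->
  (forall w, `|F w| <= M) -> P.-integrable setT (EFin \o F).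
Proof.
move=> mF FM; apply: (@integrable_bounded_by _ _ _ P F M mF).
apply: (@le_trans _ _ (\int[P]_w (cst M%:E w))%E).
  apply: ge0_le_integral => //.
  - by apply/measurable_EFinP; exact: measurableT_comp.
  - by move=> w _; rewrite lee_fin.
rewrite integral_cst// [X in (_ * X)%E](_ : _ = 1%E) ?mule1//.
exact: probability_setT.
Qed.

Lemma Rintegral_prob_cst (c : R) : (\int[P]_w c)%R = c.
Proof.
rewrite Rintegral_cst// [X in fine X](_ : _ = 1%E) ?mulr1//.
exact: probability_setT.
Qed.

Variables (X Y : {RV P >-> R}).
Hypothesis XY : indep_rv P X Y.

(** By Tonelli: the joint law of an independent pair is the product of the
marginal laws. *)
Lemma indep_integral (F : R * R -> \bar R) : measurable_fun setT F ->
  (forall z, 0 <= F z)%E ->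
  (\int[P]_w F (X w, Y w) =
   \int[distribution P X]_s \int[distribution P Y]_t F (s, t))%E.
Proof.
move=> mF F0.
pose Z w := (X w, Y w).
have mZ : measurable_fun setT Z by exact: measurable_fun_pair.
pose nu : {measure set (R * R) -> \bar R} := pushforward P Z.
transitivity (\int[nu mZ]_z F z)%E; first by rewrite ge0_integral_pushforward.
rewrite -(fubini_tonelli1 _ mF F0).
apply: eq_measure_integral => A mA _; apply/esym.
by apply: product_measure_unique => // B C mB mC; exact: XY.
Qed.

(** Nonnegative bounded functions are treated first, by Tonelli; the general
case follows by adding the constant [M] to both. *)
Lemma indep_Rintegral (phi psi : R -> R) (M : R) :
  measurable_fun setT phi -> measurable_fun setT psi ->
  (forall x, `|phi x| <= M) -> (forall x, `|psi x| <= M) ->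
  ((\int[P]_w (phi (X w) * psi (Y w))) =
   (\int[P]_w phi (X w)) * (\int[P]_w psi (Y w)))%R.
Proof.
move=> mphi mpsi phiM psiM.
have M0 : 0 <= M by exact: le_trans (phiM 0).
have key (f g : R -> R) : measurable_fun setT f -> measurable_fun setT g ->
    (forall x, 0 <= f x <= 2 * M) -> (forall x, 0 <= g x <= 2 * M) ->
  ((\int[P]_w (f (X w) * g (Y w))) =
   (\int[P]_w f (X w)) * (\int[P]_w g (Y w)))%R.
  move=> mf mg fM gM.
  have f0 x : 0 <= f x by case/andP: (fM x).
  have g0 x : 0 <= g x by case/andP: (gM x).
  have mfX : measurable_fun setT (fun w => f (X w)) by exact: measurableT_comp.
  have mgY : measurable_fun setT (fun w => g (Y w)) by exact: measurableT_comp.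
  have ifX : P.-integrable setT (EFin \o (fun w => f (X w))).
    by apply: (@integrable_bounded _ (2 * M)) => // w; rewrite ger0_norm//; case/andP: (fM (X w)).
  have igY : P.-integrable setT (EFin \o (fun w => g (Y w))).
    by apply: (@integrable_bounded _ (2 * M)) => // w; rewrite ger0_norm//; case/andP: (gM (Y w)).
  rewrite /Rintegral -fineM; [|exact: integrable_fin_num..].
  congr fine.
  rewrite (@indep_integral (fun z => (f z.1 * g z.2)%:E)); last 2 first.
  - by apply/measurable_EFinP; apply: measurable_funM; exact: measurableT_comp.
  - by move=> z; rewrite lee_fin mulr_ge0.
  have fin_g : (\int[P]_w (g (Y w))%:E)%E \is a fin_num by exact: integrable_fin_num.
  transitivity (\int[distribution P X]_s ((f s)%:E * \int[P]_w (g (Y w))%:E))%E.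
    apply: eq_integral => s _ /=.
    rewrite ge0_integral_distribution//; last 2 first.
    - by apply/measurable_EFinP; exact: measurable_funM.
    - by move=> t; rewrite lee_fin mulr_ge0.
    rewrite -ge0_integralZl//.
    - exact/measurable_EFinP.
    - by move=> w _; rewrite lee_fin.
    - by rewrite lee_fin.
  rewrite ge0_integral_distribution//; last 2 first.
  - by apply: emeasurable_funM => //; exact/measurable_EFinP.
  - by move=> t; rewrite mule_ge0 ?lee_fin// integral_ge0// => w _; rewrite lee_fin.
  rewrite -(fineK fin_g) ge0_integralZr//.
  - exact/measurable_EFinP.
  - by move=> w _; rewrite lee_fin.
  - by rewrite fineK// integral_ge0// => w _; rewrite lee_fin.
have mphiX : measurable_fun setT (fun w => phi (X w)) by exact: measurableT_comp.
have mpsiY : measurable_fun setT (fun w => psi (Y w)) by exact: measurableT_comp.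
have iphi : P.-integrable setT (EFin \o (fun w => phi (X w))).
  exact: (@integrable_bounded _ M).
have ipsi : P.-integrable setT (EFin \o (fun w => psi (Y w))).
  exact: (@integrable_bounded _ M).
have icst (c : R) : P.-integrable setT (EFin \o (fun=> c)).
  by apply: (@integrable_bounded _ `|c|).
have iprod : P.-integrable setT (EFin \o (fun w => phi (X w) * psi (Y w))).
  apply: (@integrable_bounded _ (M * M)); first exact: measurable_funM.
  by move=> w; rewrite normrM; apply: ler_pM.
(* the identity for [phi + M] and [psi + M], expanded by linearity *)
have bnd (f : R -> R) : (forall x, `|f x| <= M) -> forall x, 0 <= f x + M <= 2 * M.
  by move=> fM x; have := fM x; rewrite ler_norml => /andP[? ?]; apply/andP; split; lra.
have := key (fun x => phi x + M) (fun x => psi x + M).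
move=> /(_ _ _ (bnd _ phiM) (bnd _ psiM)).
have -> : (\int[P]_w ((phi (X w) + M) * (psi (Y w) + M)) =
    (\int[P]_w (phi (X w) * psi (Y w))) + (M * (\int[P]_w psi (Y w)) +
    (M * (\int[P]_w phi (X w)) + M * M)))%R.
  rewrite -[X in _ + (_ + (_ + X))]Rintegral_prob_cst.
  rewrite -(RintegralZl _ measurableT iphi) -(RintegralZl _ measurableT ipsi).
  have iphi' : P.-integrable setT (EFin \o (fun w => M * phi (X w))).
    by have := @integrableZl _ _ _ P setT measurableT M _ iphi; apply: eq_integrable => // w _.
  have ipsi' : P.-integrable setT (EFin \o (fun w => M * psi (Y w))).
    by have := @integrableZl _ _ _ P setT measurableT M _ ipsi; apply: eq_integrable => // w _.
  have i1 : P.-integrable setT (EFin \o (fun w => M * phi (X w) + M * M)).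
    by have := integrableD measurableT iphi' (icst (M * M)); apply: eq_integrable.
  have i2 : P.-integrable setT (EFin \o (fun w => M * psi (Y w) + (M * phi (X w) + M * M))).
    by have := integrableD measurableT ipsi' i1; apply: eq_integrable.
  rewrite -(RintegralD measurableT iphi' (icst (M * M))).
  rewrite -(RintegralD measurableT ipsi' i1) -(RintegralD measurableT iprod i2).
  by apply: eq_Rintegral => w _; ring.
rewrite (RintegralD measurableT iphi (icst M)) (RintegralD measurableT ipsi (icst M)).
rewrite !Rintegral_prob_cst => H.
have {}H := H _ _.
rewrite -[LHS](addrK (M * (\int[P]_w psi (Y w))%R + (M * (\int[P]_w phi (X w))%R + M * M))).
rewrite H; first by ring.
- exact: measurable_funD.
- exact: measurable_funD.
Qed.

End independent_pair.

(** * Integrated cross moments of two kernel bumps *)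

Section cross_moment.
Context {disp : measure_display} {T : measurableType disp} {R : realType}.
Variable P : probability T R.
Local Notation mu := (@lebesgue_measure R).
Variables (K : R -> R) (M L k0 k1 : R).
Hypotheses (mK : measurable_fun setT K) (KM : forall x, `|K x| <= M).
Hypotheses (K0 : (\int[mu]_v `|K v|%:E <= k0%:E)%E)
  (K1 : (\int[mu]_v (`|v| * `|K v|)%:E <= k1%:E)%E)
  (KL : forall x y, `|K x - K y| <= L * `|x - y|).

Let M0 : 0 <= M. Proof. by apply: le_trans (KM 0). Qed.
Let L0 : 0 <= L.
Proof. by have := KL 1 0; rewrite subr0 normr1 mulr1; apply: le_trans. Qed.
Let k00 : 0 <= k0.
Proof. by rewrite -lee_fin; apply: le_trans K0; exact: integral_ge0. Qed.
Let k10 : 0 <= k1.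
Proof.
by rewrite -lee_fin; apply: le_trans K1; apply: integral_ge0 => x _; rewrite lee_fin mulr_ge0.
Qed.

Variable b : R.
Hypothesis b0 : 0 < b.

(** The kernel of width [b] placed at [s]. *)
Definition kbump (s x : R) : R := K ((x - s) / b).

Lemma measurable_bump (X : T -> R) : measurable_fun setT X ->
  measurable_fun [set: R * T] (fun z : R * T => kbump (X z.2) z.1).
Proof.
move=> mX; apply: (measurableT_comp mK); apply: measurable_funM => //.
by apply: measurable_funB => //; exact: measurableT_comp.
Qed.

Lemma measurable_bump1 (s : R) : measurable_fun setT (kbump s).
Proof.
by apply: (measurableT_comp mK); apply: measurable_funM => //; exact: measurable_funB.
Qed.

Lemma measurable_bump2 (x : R) : measurable_fun setT (kbump^~ x).
Proof.
by apply: (measurableT_comp mK); apply: measurable_funM => //; exact: measurable_funB.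
Qed.

Lemma ge0_integral_bump (phi : R -> \bar R) (s : R) :
  measurable_fun setT phi -> (forall x, 0 <= phi x)%E ->
  (\int[mu]_x phi ((x - s) / b)%R = b%:E * \int[mu]_v phi v)%E.
Proof.
move=> mphi phi0; have bi0 : 0 < b^-1 by rewrite invr_gt0.
rewrite -[X in (X%:E * _)%E]invrK -(ge0_integral_affine (- s / b) bi0 mphi phi0).
by apply: eq_integral => x _; congr phi; ring.
Qed.

Lemma integral_abs_bump (s : R) : (\int[mu]_x `|kbump s x|%:E <= (b * k0)%:E)%E.
Proof.
rewrite (ge0_integral_bump (phi := fun v => `|K v|%:E))//; last first.
  by apply/measurable_EFinP; exact: measurableT_comp.
by rewrite EFinM lee_wpmul2l// lee_fin ltW.
Qed.

Section two.
Variables (X1 X2 : T -> R).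
Hypotheses (mX1 : measurable_fun setT X1) (mX2 : measurable_fun setT X2).

(** The mixed moment, at the point [x], of the bumps placed at two random
points. *)
Definition cross (x : R) : R := (\int[P]_w (kbump (X1 w) x * kbump (X2 w) x))%R.

Let F (z : R * T) : R := kbump (X1 z.2) z.1 * kbump (X2 z.2) z.1.

Let mF : measurable_fun setT F.
Proof. by apply: measurable_funM; exact: measurable_bump. Qed.

Let intF_le w : (\int[mu]_x `|F (x, w)|%:E <= (M * (b * k0))%:E)%E.
Proof.
rewrite EFinM.
apply: (@le_trans _ _ (M%:E * \int[mu]_x `|kbump (X2 w) x|%:E)%E); last first.
  by apply: lee_wpmul2l; [rewrite lee_fin|exact: integral_abs_bump].
have mb2 := measurable_bump1 (X2 w); have mb1 := measurable_bump1 (X1 w).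
rewrite -ge0_integralZl//; last by apply/measurable_EFinP; exact: measurableT_comp.
apply: ge0_le_integral => //.
- apply/measurable_EFinP; apply: measurableT_comp => //; exact: measurable_funM.
- by apply/measurable_EFinP; apply: measurable_funM => //; exact: measurableT_comp.
by move=> x _; rewrite -EFinM lee_fin normrM ler_wpM2r// KM.
Qed.

Let intF : (mu \x P)%E.-integrable setT (EFin \o F).
Proof.
apply/integrable21ltyP; first exact/measurable_EFinP.
apply: (@le_lt_trans _ _ (\int[P]_w (cst (M * (b * k0))%:E w))%E); last first.
  rewrite integral_cst// [X in (_ * X)%E](_ : _ = 1%E) ?mule1 ?ltry//.
  exact: probability_setT.
apply: ge0_le_integral => //.
- by move=> w _; exact: integral_ge0.
- apply: (@measurable_fun_fubini_tonelli_G _ _ _ _ R mu (fun z => `|(F z)%:E|%E)) => //.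
  by apply: measurableT_comp => //; exact/measurable_EFinP.
by move=> w _; exact: intF_le.
Qed.

Let crossE x : (cross x)%:E = (\int[P]_w (F (x, w))%:E)%E.
Proof.
rewrite /cross EFin_Rintegral//; apply: (@integrable_bounded _ _ _ P _ (M * M)).
  apply: measurable_funM; exact: (measurableT_comp (measurable_bump2 x)).
by move=> w; rewrite normrM; apply: ler_pM => //; exact: KM.
Qed.

Lemma integrable_cross : mu.-integrable setT (EFin \o cross).
Proof.
apply: eq_integrable (integrable_fubini_F intF) => //.
by move=> x _; rewrite /= crossE.
Qed.

(** Integrated over [x], the mixed moment depends on the two random points
through their difference only. *)
Lemma Rintegral_cross : (\int[mu]_x cross x)%R =
  (\int[P]_w (b * autocorr K ((X1 w - X2 w) / b)))%R.
Proof.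
rewrite /Rintegral; congr fine.
under eq_integral do rewrite crossE.
rewrite (Fubini intF); apply: eq_integral => w _.
rewrite -(@autocorr_scale R K M k0 mK KM K0 b (X1 w) (X2 w) b0).
rewrite EFin_Rintegral//.
apply: (@integrable_bounded_by _ (measurableTypeR R) R mu _ (M * (b * k0))).
  by apply: measurable_funM; exact: measurable_bump1.
exact: intF_le.
Qed.

End two.

Section compare.
Variables (X1 X2 : T -> R) (X X' : {RV P >-> R}) (f : R -> R) (Mf D : R).
Hypotheses (mX1 : measurable_fun setT X1) (mX2 : measurable_fun setT X2).
Hypotheses (hX : is_density P X f) (hX' : is_density P X' f).
Hypothesis XX' : indep_rv P X X'.
Hypothesis fM : forall x, f x <= Mf.
Hypothesis D0 : 0 < D.
Hypothesis hD : (\int[P]_w `|X1 w - X w|%:E + \int[P]_w `|X2 w - X' w|%:E <= D%:E)%E.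

Lemma cross_indep x : cross X X' x =
  ((\int[P]_w kbump (X w) x) * (\int[P]_w kbump (X' w) x))%R.
Proof.
exact: (indep_Rintegral XX' (measurable_bump2 x) (measurable_bump2 x)
  (fun s => KM _) (fun s => KM _)).
Qed.

Let C1 := 6 * L * k0 * M * k1 + 8 * (M * k0) ^+ 2.

(** A constant [c >= 1] such that [autocorr] has oscillation at most [c], and
[autocorr_sqr] holds with constant [c ^+ 2]. *)
Definition cov_const := 1 + C1 + 2 * (M * k0).

Lemma cov_const_gt0 : 0 < cov_const.
Proof.
rewrite /cov_const /C1.
have : 0 <= 6 * L * k0 * M * k1 by rewrite !mulr_ge0.
have : 0 <= 8 * (M * k0) ^+ 2 by rewrite mulr_ge0// sqr_ge0.
have : 0 <= 2 * (M * k0) by rewrite !mulr_ge0.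
lra.
Qed.

Let U w := X1 w - X2 w.
Let U' w := X w - X' w.

Let mU : measurable_fun setT U. Proof. exact: measurable_funB. Qed.
Let mU' : measurable_fun setT U'. Proof. exact: measurable_funB. Qed.

(** An independent pair with a density almost surely has distinct components. *)
Lemma tie_null : P [set w | U' w = 0] = 0%E.
Proof.
pose F (z : R * R) : \bar R := (\1_[set (0 : R)] (z.1 - z.2))%:E.
have mi0 : measurable_fun setT (\1_[set (0 : R)] : R -> R).
  exact: measurable_indic.
have mF : measurable_fun setT F.
  apply/measurable_EFinP; apply: (measurableT_comp mi0).
  exact: measurable_funB.
have mtie : measurable [set w | U' w = 0].
  by rewrite -[X in measurable X]setTI; exact: (mU' measurableT (measurable_set1 0)).
transitivity (\int[P]_w F (X w, X' w))%E.
  transitivity (\int[P]_w (\1_[set w | U' w = 0] w)%:E)%E.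
    by rewrite integral_indic// setIT.
  by [].
rewrite indep_integral//; last by move=> z; rewrite lee_fin.
apply: integral0_eq => s _.
have [mf f0 hX'f] := hX'.
rewrite /F/= ge0_integral_distribution//; last first.
  apply/measurable_EFinP; apply: (measurableT_comp mi0).
  exact: measurable_funB.
transitivity (P (X' @^-1` [set s])).
  transitivity (\int[P]_w (\1_(X' @^-1` [set s]) w)%:E)%E.
    apply: eq_integral => w _ /=; rewrite !indicE; congr ((nat_of_bool _)%:R%:E).
    apply/idP/idP; rewrite !inE/=.
      by move/subr0_eq.
    by move=> ->; rewrite subrr.
  by rewrite integral_indic// setIT.
by rewrite hX'f// integral_set1.
Qed.

Lemma integral_inv_pow_diff :
  (\int[P]_w (`|U' w| `^ (- (3 / 4)))%:E <= (1 + 8 * Mf)%:E)%E.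
Proof.
pose F (z : R * R) : \bar R := (`|z.1 - z.2| `^ (- (3 / 4)))%:E.
have mF : measurable_fun setT F.
  apply/measurable_EFinP; apply: (measurableT_comp (measurable_powR _)).
  by apply: measurableT_comp => //; exact: measurable_funB.
rewrite (_ : (\int[P]_w _)%E = (\int[P]_w F (X w, X' w))%E)//.
rewrite indep_integral//; last by move=> z; rewrite lee_fin powR_ge0.
apply: (@le_trans _ _ (\int[distribution P X]_s (cst (1 + 8 * Mf)%:E s))%E); last first.
  rewrite integral_cst// [X in (_ * X)%E](_ : _ = 1%E) ?mule1//.
  exact: probability_setT.
have [mf f0 _] := hX'.
apply: ge0_le_integral => //.
- by move=> s _; apply: integral_ge0 => t _; rewrite lee_fin powR_ge0.
- apply: (@measurable_fun_fubini_tonelli_F _ _ _ _ R (distribution P X') F) => //.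
  by move=> z; rewrite lee_fin powR_ge0.
move=> s _; rewrite /F/=.
have mp : measurable_fun setT (fun t : R => (`|s - t| `^ (- (3 / 4)))%:E).
  apply/measurable_EFinP; apply: (measurableT_comp (measurable_powR _)).
  by apply: measurableT_comp => //; exact: measurable_funB.
have p0 (t : R) : (0 <= (`|s - t| `^ (- (3 / 4)))%:E)%E by rewrite lee_fin powR_ge0.
rewrite ge0_integral_distribution//=.
rewrite (ge0_integral_density _ hX' mp p0)//.
by apply: integral_abs_powR_density => //; exact: density_integral1 hX'.
Qed.

Lemma autocorr_diff_le w : U' w != 0 ->
  `|autocorr K (U w / b) - autocorr K (U' w / b)| <=
  cov_const * D `^ (3 / 7) * (`|U w - U' w| / D + `|U' w| `^ (- (3 / 4))).
Proof.
move=> U'0.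
have C0 := cov_const_gt0.
have hC1 : 0 <= C1 by rewrite /C1 addr_ge0 ?mulr_ge0// sqr_ge0.
have Mk0 : 0 <= M * k0 by rewrite mulr_ge0.
apply: young_interpolation => //.
- by rewrite normr_gt0.
- have h1 := autocorr_bounded mK KM K0 (U w / b).
  have h2 := autocorr_bounded mK KM K0 (U' w / b).
  apply: (le_trans (ler_normB _ _)); rewrite /cov_const; lra.
- have := autocorr_sqr mK KM K0 K1 KL (U w / b) (U' w / b).
  rewrite -mulrBl !normrM (gtr0_norm (_ : 0 < b^-1)) ?invr_gt0// -/C1.
  rewrite !mulrA ler_pM2r ?invr_gt0// => h.
  rewrite real_normK ?num_real//; apply: (le_trans h).
  apply: ler_wpM2r => //.
  by rewrite /cov_const; nra.
Qed.

(** [X1] and [X2] are arbitrary, [X] and [X'] independent with a bounded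
density; the bound depends on the former only through the L1 distance [D]. *)
Lemma Rintegral_cross_diff :
  ((\int[mu]_x cross X1 X2 x) - (\int[mu]_x cross X X' x))%R <=
  b * (cov_const * D `^ (3 / 7) * (2 + 8 * Mf)).
Proof.
rewrite !Rintegral_cross//.
have C0 := cov_const_gt0.
have Mk0 : 0 <= M * k0 by rewrite mulr_ge0.
have mH : measurable_fun setT (autocorr K).
  apply: continuous_measurable_fun.
  apply: (@lipschitz_continuous _ _ (L * k0 + 1)); first by rewrite ltr_wpDl// mulr_ge0.
  move=> u u'; apply: (le_trans (autocorr_lipschitz mK KM K0 KL u u')).
  by apply: ler_wpM2r => //; rewrite lerDl.
have mHU (V : T -> R) : measurable_fun setT V ->
    measurable_fun setT (fun w => b * autocorr K (V w / b)).
  move=> mV; apply: measurable_funM => //.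
  by apply: (measurableT_comp mH); exact: measurable_funM.
have iHU (V : T -> R) : measurable_fun setT V ->
    P.-integrable setT (EFin \o (fun w => b * autocorr K (V w / b))).
  move=> mV; apply: (@integrable_bounded _ _ _ P _ (b * (M * k0))); first exact: mHU.
  move=> w; rewrite normrM gtr0_norm// ler_pM2l//.
  exact: (autocorr_bounded mK KM K0).
rewrite -(RintegralB measurableT (iHU _ mU) (iHU _ mU')).
apply: (le_trans (ler_norm _)).
have mB := measurable_funB (mHU _ mU) (mHU _ mU').
apply: (Rintegral_abs_le mB).
set c := cov_const * D `^ (3 / 7).
have c0 : 0 <= c by rewrite mulr_ge0 ?powR_ge0// ltW.
pose g w := `|U w - U' w| / D + `|U' w| `^ (- (3 / 4)).
have g0 w : 0 <= g w by rewrite addr_ge0 ?powR_ge0 ?divr_ge0// ltW.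
have mUU' : measurable_fun setT (fun w => `|U w - U' w|).
  by apply: measurableT_comp => //; exact: measurable_funB.
have mp : measurable_fun setT (fun w => `|U' w| `^ (- (3 / 4))).
  by apply: (measurableT_comp (measurable_powR _)); exact: measurableT_comp.
have mg : measurable_fun setT g.
  by apply: measurable_funD => //; exact: measurable_funM.
apply: (@le_trans _ _ (\int[P]_w (b * c * g w)%:E)%E).
  apply: ae_ge0_le_integral => //.
  - by apply/measurable_EFinP; exact: measurableT_comp.
  - move=> w _; rewrite lee_fin; apply: mulr_ge0; last exact: g0.
    by apply: mulr_ge0 => //; exact: ltW.
  - by apply/measurable_EFinP; exact: measurable_funM.
  (* the pointwise bound fails at most on the null set of ties *)
  exists [set w | U' w = 0]; split.
  - by rewrite -[X in measurable X]setTI; exact: (mU' measurableT (measurable_set1 0)).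
  - exact: tie_null.
  move=> w /= h; apply: contra_notP h => U'0 _.
  rewrite lee_fin -mulrBr normrM gtr0_norm// -mulrA ler_pM2l//.
  by apply: autocorr_diff_le; exact/eqP.
under eq_integral do rewrite EFinM.
rewrite ge0_integralZl//; last 3 first.
- exact/measurable_EFinP.
- by move=> w _; rewrite lee_fin.
- by rewrite lee_fin mulr_ge0// ltW.
rewrite mulrA [leRHS]EFinM; apply: lee_wpmul2l; first by rewrite lee_fin mulr_ge0// ltW.
rewrite /g; under eq_integral do rewrite EFinD.
rewrite ge0_integralD//; last 3 first.
- by move=> w _; rewrite lee_fin divr_ge0// ltW.
- by apply/measurable_EFinP; exact: measurable_funM.
- exact/measurable_EFinP.
rewrite (_ : 2 + 8 * Mf = 1 + (1 + 8 * Mf)); last by ring.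
rewrite EFinD; apply: leeD; last exact: integral_inv_pow_diff.
under eq_integral do rewrite EFinM.
rewrite ge0_integralZr//; last 2 first.
- exact/measurable_EFinP.
- by rewrite lee_fin invr_ge0 ltW.
rewrite lee_pdivrMr// mul1e; apply: le_trans hD.
rewrite -ge0_integralD//; last 2 first.
- by apply/measurable_EFinP; apply: measurableT_comp => //; exact: measurable_funB.
- by apply/measurable_EFinP; apply: measurableT_comp => //; exact: measurable_funB.
apply: ge0_le_integral => //.
- exact/measurable_EFinP.
- by apply: emeasurable_funD; apply/measurable_EFinP; apply: measurableT_comp => //; exact: measurable_funB.
move=> w _; rewrite -EFinD lee_fin /U /U'.
rewrite (_ : X1 w - X2 w - (X w - X' w) = (X1 w - X w) - (X2 w - X' w)); last by ring.
exact: ler_normB.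
Qed.

End compare.

End cross_moment.

(** * Integrated variance, bias and truncation of the L1 error *)

Section Rintegral_sum.
Context d (T : measurableType d) (R : realType).
Variable mu : {measure set T -> \bar R}.

Lemma integrable_sum_seq (I : Type) (l : seq I) (F : I -> T -> R) :
  (forall i, mu.-integrable setT (EFin \o F i)) ->
  mu.-integrable setT (EFin \o (fun x => \sum_(i <- l) F i x)).
Proof.
move=> iF; elim: l => [|i l IH].
  rewrite (_ : _ \o _ = fun=> 0%E); last by apply/funext => x /=; rewrite big_nil.
  exact: integrable0.
have := integrableD measurableT (iF i) IH; apply: eq_integrable => // x _.
by rewrite /= big_cons EFinD.
Qed.

Lemma Rintegral_sum (I : Type) (l : seq I) (F : I -> T -> R) :
  (forall i, mu.-integrable setT (EFin \o F i)) ->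
  (\int[mu]_x (\sum_(i <- l) F i x) = \sum_(i <- l) \int[mu]_x F i x)%R.
Proof.
move=> iF; elim: l => [|i l IH].
  rewrite big_nil; under eq_Rintegral do rewrite big_nil.
  by rewrite /Rintegral integral0.
rewrite big_cons -IH -(RintegralD measurableT (iF i) (integrable_sum_seq l iF)).
by apply: eq_Rintegral => x _; rewrite big_cons.
Qed.

End Rintegral_sum.

Section variance.
Context {disp : measure_display} {T : measurableType disp} {R : realType}.
Variable P : probability T R.
Local Notation mu := (@lebesgue_measure R).
Variables (K : R -> R) (M k0 : R).
Hypotheses (mK : measurable_fun setT K) (KM : forall x, `|K x| <= M).
Hypotheses (K0 : (\int[mu]_v `|K v|%:E <= k0%:E)%E).
Variable b : R.
Hypothesis b0 : 0 < b.
Variables (I : Type) (l : seq I) (X : I -> T -> R) (y : R -> R).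
Hypothesis mX : forall i, measurable_fun setT (X i).
Hypothesis EX : forall i x, (\int[P]_w kbump K b (X i w) x)%R = y x.
Hypothesis my : measurable_fun setT y.
Hypothesis iy2 : mu.-integrable setT (EFin \o (fun x => y x * y x)).

Local Notation Y i w x := (kbump K b (X i w) x).

Let mY i x : measurable_fun setT (fun w => Y i w x).
Proof. exact: (measurableT_comp (measurable_bump2 mK b x)). Qed.

Let iY i x : P.-integrable setT (EFin \o (fun w => Y i w x)).
Proof. by apply: (@integrable_bounded _ _ _ P _ M) => // w; exact: KM. Qed.

(** The covariance of two bumps at the point [x], when all of them have the
same mean [y]. *)
Lemma covariance_bump i j x :
  (\int[P]_w ((Y i w x - y x) * (Y j w x - y x)))%R =
  cross P K b (X i) (X j) x - y x * y x.
Proof.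
have iYY : P.-integrable setT (EFin \o (fun w => Y i w x * Y j w x)).
  apply: (@integrable_bounded _ _ _ P _ (M * M)); first exact: measurable_funM.
  by move=> w; rewrite normrM; apply: ler_pM => //; exact: KM.
have iZ (c : R) k : P.-integrable setT (EFin \o (fun w => c * Y k w x)).
  apply: (@integrable_bounded _ _ _ P _ (`|c| * M)); first exact: measurable_funM.
  by move=> w; rewrite normrM; apply: ler_wpM2l => //; exact: KM.
have ic (c : R) : P.-integrable setT (EFin \o (fun=> c)).
  by apply: (@integrable_bounded _ _ _ P _ `|c|).
have i1 : P.-integrable setT (EFin \o (fun w => - y x * Y j w x + y x * y x)).
  by have := integrableD measurableT (iZ (- y x) j) (ic (y x * y x)); apply: eq_integrable.
have i2 : P.-integrable setT
    (EFin \o (fun w => - y x * Y i w x + (- y x * Y j w x + y x * y x))).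
  by have := integrableD measurableT (iZ (- y x) i) i1; apply: eq_integrable.
transitivity (\int[P]_w (Y i w x * Y j w x +
   (- y x * Y i w x + (- y x * Y j w x + y x * y x))))%R.
  by apply: eq_Rintegral => w _; ring.
rewrite (RintegralD measurableT iYY i2) (RintegralD measurableT (iZ _ i) i1).
rewrite (RintegralD measurableT (iZ _ j) (ic _)) !(RintegralZl _ measurableT (iY _ _)).
rewrite Rintegral_prob_cst !EX /cross; ring.
Qed.

Lemma integrated_variance :
  (\int[P]_w \int[mu]_x ((\sum_(i <- l) (Y i w x - y x)) ^+ 2)%:E =
   (\sum_(i <- l) \sum_(j <- l)
     ((\int[mu]_x cross P K b (X i) (X j) x) - \int[mu]_x (y x * y x)))%R%:E)%E.
Proof.
pose F (z : T * R) : \bar R := ((\sum_(i <- l) (Y i z.1 z.2 - y z.2)) ^+ 2)%:E.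
have mF : measurable_fun setT F.
  apply/measurable_EFinP; apply: measurable_funX; apply: measurable_sum => i.
  apply: measurable_funB; last exact: measurableT_comp.
  apply: (measurableT_comp mK); apply: measurable_funM => //.
  by apply: measurable_funB => //; exact: measurableT_comp.
have F0 z : (0 <= F z)%E by rewrite lee_fin sqr_ge0.
apply: (etrans (@fubini_tonelli _ _ _ _ R P mu F mF F0)).
have ie i j : mu.-integrable setT
    (EFin \o (fun x => cross P K b (X i) (X j) x - y x * y x)).
  have := integrableB measurableT
    (integrable_cross P mK KM K0 b0 (mX i) (mX j)) iy2.
  by apply: eq_integrable.
transitivity (\int[mu]_x (\sum_(i <- l) \sum_(j <- l)
    (cross P K b (X i) (X j) x - y x * y x))%R%:E)%E.
  apply: eq_integral => x _.
  have iZZ i j : P.-integrable setT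
      (EFin \o (fun w => (Y i w x - y x) * (Y j w x - y x))).
    apply: (@integrable_bounded _ _ _ P _ ((M + `|y x|) * (M + `|y x|))).
      by apply: measurable_funM; exact: measurable_funB.
    by move=> w; rewrite normrM; apply: ler_pM => //;
      apply: (le_trans (ler_normB _ _)); rewrite lerD2r; exact: KM.
  rewrite -(EFin_Rintegral (f := fun w => (\sum_(i <- l) (Y i w x - y x)) ^+ 2)); last first.
    have := integrable_sum_seq l (fun i => integrable_sum_seq l (iZZ i)).
    apply: eq_integrable => // w _ /=; congr (_%:E).
    by rewrite expr2 mulr_suml; apply: eq_bigr => i _; rewrite mulr_sumr.
  congr (_%:E).
  transitivity (\int[P]_w (\sum_(i <- l) \sum_(j <- l) (Y i w x - y x) * (Y j w x - y x)))%R.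
    apply: eq_Rintegral => w _.
    by rewrite expr2 mulr_suml; apply: eq_bigr => i _; rewrite mulr_sumr.
  rewrite Rintegral_sum; last by move=> i; exact: integrable_sum_seq.
  apply: eq_bigr => i _; rewrite Rintegral_sum//.
  by apply: eq_bigr => j _; exact: covariance_bump.
rewrite -EFin_Rintegral; last first.
  by apply: integrable_sum_seq => i; exact: integrable_sum_seq.
rewrite Rintegral_sum; last by move=> i; exact: integrable_sum_seq.
congr (_%:E); apply: eq_bigr => i _; rewrite Rintegral_sum//.
apply: eq_bigr => j _; rewrite RintegralB//.
exact: (integrable_cross P mK KM K0 b0 (mX i) (mX j)).
Qed.

End variance.

Section bias.
Context {disp : measure_display} {T : measurableType disp} {R : realType}.
Variable P : probability T R.
Local Notation mu := (@lebesgue_measure R).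
Variables (K : R -> R) (M k0 k1 k2 b : R).
Hypotheses (mK : measurable_fun setT K) (KM : forall x, `|K x| <= M).
Hypotheses (K0 : (\int[mu]_v `|K v|%:E <= k0%:E)%E)
  (K1 : (\int[mu]_v (`|v| * `|K v|)%:E <= k1%:E)%E)
  (K2 : (\int[mu]_v (v ^+ 2 * `|K v|)%:E <= k2%:E)%E).
Hypothesis KI : (\int[mu]_v (K v)%:E = 1)%E.
Hypothesis b0 : 0 < b.

Lemma second_moment_bump (s : R) :
  (\int[mu]_x (x ^+ 2 * `|kbump K b s x|)%:E <= (b * (2 * (s ^+ 2 * k0 + b ^+ 2 * k2)))%:E)%E.
Proof.
have mnK : measurable_fun setT (fun v => `|K v|) by exact: measurableT_comp.
have mv2 : measurable_fun setT (fun v : R => v ^+ 2 * `|K v|).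
  by apply: measurable_funM => //; exact: measurable_funX.
pose phi (v : R) := ((s + b * v) ^+ 2 * `|K v|)%:E.
have mphi : measurable_fun setT phi.
  apply/measurable_EFinP; apply: measurable_funM => //.
  by apply: measurable_funX; apply: measurable_funD => //; exact: measurable_funM.
have phi0 v : (0 <= phi v)%E by rewrite lee_fin mulr_ge0// sqr_ge0.
have -> : (\int[mu]_x (x ^+ 2 * `|kbump K b s x|)%:E =
    \int[mu]_x phi ((x - s) / b)%R)%E.
  apply: eq_integral => x _.
  rewrite /phi /kbump (_ : s + b * ((x - s) / b) = x)//.
  by field; rewrite gt_eqF.
rewrite (ge0_integral_bump b0 s mphi phi0) [leRHS]EFinM.
apply: lee_wpmul2l; first by rewrite lee_fin ltW.
pose G (v : R) := ((2 * s ^+ 2)%:E * `|K v|%:E + (2 * b ^+ 2)%:E * (v ^+ 2 * `|K v|)%:E)%E.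
apply: (@le_trans _ _ (\int[mu]_v G v)%E).
  apply: ge0_le_integral => //.
  - by apply: emeasurable_funD; apply/measurable_EFinP; exact: measurable_funM.
  move=> v _; rewrite /phi /G -!EFinM -EFinD lee_fin.
  rewrite [leRHS](_ : _ = (2 * s ^+ 2 + 2 * b ^+ 2 * v ^+ 2) * `|K v|); last by ring.
  apply: ler_wpM2r => //.
  have := sqr_ge0 (s - b * v); nra.
have s20 : 0 <= 2 * s ^+ 2 by apply: mulr_ge0 => //; exact: sqr_ge0.
have b20 : 0 <= 2 * b ^+ 2 by apply: mulr_ge0 => //; exact: sqr_ge0.
have vK0 (v : R) : 0 <= v ^+ 2 * `|K v| by apply: mulr_ge0 => //; exact: sqr_ge0.
have e1 : (\int[mu]_v ((2 * s ^+ 2)%:E * `|K v|%:E) =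
    (2 * s ^+ 2)%:E * \int[mu]_v `|K v|%:E)%E.
  by rewrite ge0_integralZl//; exact/measurable_EFinP.
have e2 : (\int[mu]_v ((2 * b ^+ 2)%:E * (v ^+ 2 * `|K v|)%:E) =
    (2 * b ^+ 2)%:E * \int[mu]_v (v ^+ 2 * `|K v|)%:E)%E.
  by rewrite ge0_integralZl//; [exact/measurable_EFinP|move=> v _; rewrite lee_fin].
rewrite /G ge0_integralD//; last 4 first.
- by move=> v _; rewrite -EFinM lee_fin mulr_ge0.
- by apply/measurable_EFinP; exact: measurable_funM.
- by move=> v _; rewrite -EFinM lee_fin mulr_ge0.
- by apply/measurable_EFinP; exact: measurable_funM.
rewrite e1 e2.
rewrite (_ : 2 * (s ^+ 2 * k0 + b ^+ 2 * k2) = (2 * s ^+ 2) * k0 + (2 * b ^+ 2) * k2); last by ring.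
by rewrite EFinD; apply: leeD; rewrite [leRHS]EFinM; apply: lee_wpmul2l; rewrite ?lee_fin.
Qed.

(** The difference is the integral of [K v * (f (x - b * v) - f x)] over [v]. *)
Lemma bias_le (X : T -> R) (f : R -> R) (Lf : R) (x : R) :
  measurable_fun setT X -> is_density P X f ->
  0 <= Lf -> (forall u v, `|f u - f v| <= Lf * `|u - v|) ->
  `|(\int[P]_w kbump K b (X w) x)%R / b - f x| <= Lf * b * k1.
Proof.
move=> mX hX Lf0 fL.
have [mf f0 _] := hX.
have mb : measurable_fun setT (fun t : R => kbump K b t x) by exact: measurable_bump2.
have revscale (phi : R -> \bar R) : measurable_fun setT phi -> (forall x, 0 <= phi x)%E ->
    (\int[mu]_t phi ((x - t) / b)%R = b%:E * \int[mu]_v phi v)%E.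
  move=> mphi phi0; rewrite -(ge0_integral_bump b0 0 mphi phi0).
  have mpsi : measurable_fun setT (fun u : R => phi ((u - 0) / b)).
    by apply: (measurableT_comp mphi); apply: measurable_funM => //; exact: measurable_funB.
  rewrite -(ge0_integral_reflect x mpsi)//.
  by apply: eq_integral => t _; rewrite subr0.
pose c (t : R) := K ((x - t) / b).
have mc : measurable_fun setT c by exact: mb.
have mnc : measurable_fun setT (fun t => `|c t|) by exact: measurableT_comp.
have ic : mu.-integrable setT (EFin \o c).
  apply: (@integrable_bounded_by _ (measurableTypeR R) R mu c (b * k0) mc).
  rewrite (revscale (fun v => `|K v|%:E))//.
    by rewrite [leRHS]EFinM; apply: lee_wpmul2l => //; rewrite lee_fin ltW.
  by apply/measurable_EFinP; exact: measurableT_comp.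
have iK : mu.-integrable setT (EFin \o K).
  exact: (@integrable_bounded_by _ (measurableTypeR R) R mu K k0 mK).
have Ec : (\int[mu]_t c t)%R = b.
  have := signed_change revscale iK; rewrite -/(Rintegral _ _ _) => ->.
  by rewrite /Rintegral KI mulr1.
have mcf : measurable_fun setT (fun t => c t * (f t - f x)).
  by apply: measurable_funM => //; exact: measurable_funB.
have cf_le : (\int[mu]_t `|c t * (f t - f x)|%:E <= (b * (Lf * b * k1))%:E)%E.
  pose phi (v : R) := (Lf * b * (`|v| * `|K v|))%:E.
  have mphi0 : measurable_fun setT (fun v : R => `|v| * `|K v|).
    by apply: measurable_funM => //; exact: measurableT_comp.
  have mphi : measurable_fun setT phi.
    by apply/measurable_EFinP; exact: measurable_funM.
  have Lb0 : 0 <= Lf * b by rewrite mulr_ge0// ltW.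
  have phi0 v : (0 <= phi v)%E by rewrite lee_fin mulr_ge0// mulr_ge0.
  apply: (@le_trans _ _ (\int[mu]_t phi ((x - t) / b)%R)%E).
    apply: ge0_le_integral => //.
    - by apply/measurable_EFinP; exact: measurableT_comp.
    - apply: (measurableT_comp mphi); apply: measurable_funM => //.
      exact: measurable_funB.
    move=> t _; rewrite /phi lee_fin normrM mulrC /c mulrA ler_wpM2r//.
    apply: (le_trans (fL _ _)); rewrite -mulrA ler_wpM2l//.
    by rewrite -{1}(gtr0_norm b0) -normrM mulrC divfK ?gt_eqF// distrC.
  rewrite (revscale _ mphi phi0) [leRHS]EFinM; apply: lee_wpmul2l; first by rewrite lee_fin ltW.
  rewrite /phi; under eq_integral do rewrite EFinM.
  rewrite ge0_integralZl//.
  - by rewrite [leRHS]EFinM; apply: lee_wpmul2l => //; rewrite lee_fin.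
  - exact/measurable_EFinP.
have icf : mu.-integrable setT (EFin \o (fun t => c t * (f t - f x))).
  exact: (@integrable_bounded_by _ (measurableTypeR R) R mu _ _ mcf cf_le).
have icx : mu.-integrable setT (EFin \o (fun t => f x * c t)).
  by have := @integrableZl _ _ _ mu setT measurableT (f x) _ ic; apply: eq_integrable.
have -> : (\int[P]_w kbump K b (X w) x)%R = (\int[mu]_t (c t * f t))%R.
  rewrite /Rintegral; congr fine.
  exact: (integral_density mX hX mb).
have -> : (\int[mu]_t (c t * f t))%R =
    (\int[mu]_t (c t * (f t - f x)))%R + f x * b.
  rewrite -[X in _ * X]Ec -(RintegralZl _ measurableT ic) -(RintegralD measurableT icf icx).
  by apply: eq_Rintegral => t _; ring.
have -> : ((\int[mu]_t (c t * (f t - f x)))%R + f x * b) / b - f x =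
    (\int[mu]_t (c t * (f t - f x)))%R / b.
  by field; rewrite gt_eqF.
rewrite normrM (gtr0_norm (_ : 0 < b^-1)) ?invr_gt0// ler_pdivrMr// [leRHS]mulrC.
by apply: (@Rintegral_abs_le _ (measurableTypeR R) R mu _ _ mcf); exact: cf_le.
Qed.

End bias.

Section split.
Context {R : realType}.
Local Notation mu := (@lebesgue_measure R).

(** The truncation argument: Young's inequality between [- A] and [A],
Markov's outside. *)
Lemma L1_split (h m f : R -> R) (A s beta : R) : 0 < A -> 0 < s ->
  measurable_fun setT h -> measurable_fun setT m -> measurable_fun setT f ->
  (forall x, 0 <= f x) -> 0 <= beta ->
  (forall x, `|m x - f x| <= beta) ->
  (\int[mu]_x `|h x - f x|%:E <= (2 * A * (s / 2 + beta))%:E +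
    ((2 * s)^-1%:E * \int[mu]_x ((h x - m x) ^+ 2)%:E +
     ((A ^+ 2)^-1)%:E * (\int[mu]_x (x ^+ 2 * `|h x|)%:E +
                       \int[mu]_x (x ^+ 2 * f x)%:E)))%E.
Proof.
move=> A0 s0 mh mm mf f0 beta0 mfb.
pose D : set R := `[- A, A]%classic.
have mD : measurable D by exact: measurable_itv.
have c0 : 0 <= s / 2 + beta by rewrite addr_ge0// divr_ge0// ltW.
have A2 : 0 < (A ^+ 2)^-1 by rewrite invr_gt0 exprn_gt0.
have s2 : 0 < (2 * s)^-1 by rewrite invr_gt0 mulr_gt0.
pose F1 (x : R) := (s / 2 + beta) * \1_D x.
pose F2 (x : R) := (2 * s)^-1 * (h x - m x) ^+ 2.
pose F3 (x : R) := (A ^+ 2)^-1 * (x ^+ 2 * `|h x|).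
pose F4 (x : R) := (A ^+ 2)^-1 * (x ^+ 2 * f x).
have F10 x : 0 <= F1 x by rewrite mulr_ge0.
have F20 x : 0 <= F2 x by apply: mulr_ge0; [exact: ltW|exact: sqr_ge0].
have F30 x : 0 <= F3 x.
  by apply: mulr_ge0; [exact: ltW|apply: mulr_ge0 => //; exact: sqr_ge0].
have F40 x : 0 <= F4 x.
  by apply: mulr_ge0; [exact: ltW|apply: mulr_ge0 => //; exact: sqr_ge0].
have mhm : measurable_fun setT (fun x => (h x - m x) ^+ 2).
  by apply: measurable_funX; exact: measurable_funB.
have mxh : measurable_fun setT (fun x : R => x ^+ 2 * `|h x|).
  by apply: measurable_funM; [exact: measurable_funX|exact: measurableT_comp].
have mxf : measurable_fun setT (fun x : R => x ^+ 2 * f x).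
  by apply: measurable_funM => //; exact: measurable_funX.
have mF1 : measurable_fun setT (EFin \o F1).
  by apply/measurable_EFinP; rewrite /F1; apply: measurable_funM => //; exact: measurable_indic.
have mF2 : measurable_fun setT (EFin \o F2).
  by apply/measurable_EFinP; rewrite /F2; exact: measurable_funM.
have mF3 : measurable_fun setT (EFin \o F3).
  by apply/measurable_EFinP; rewrite /F3; exact: measurable_funM.
have mF4 : measurable_fun setT (EFin \o F4).
  by apply/measurable_EFinP; rewrite /F4; exact: measurable_funM.
apply: (@le_trans _ _ (\int[mu]_x ((F1 x)%:E + ((F2 x)%:E + ((F3 x)%:E + (F4 x)%:E)))%E)%E).
  apply: ge0_le_integral => //.
  - by apply/measurable_EFinP; apply: measurableT_comp => //; exact: measurable_funB.
  - by do 3 apply: emeasurable_funD => //.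
  move=> x _; rewrite -!EFinD lee_fin.
  have := F10 x; have := F20 x; have := F30 x; have := F40 x.
  have [xA|xA] := leP `|x| A.
    move=> h4 h3 h2 h1.
    have -> : F1 x = s / 2 + beta.
      by rewrite /F1 indicE mem_set ?mulr1// /D/= in_itv/= -ler_norml.
    (* the difference of the two sides is [(z - s) ^+ 2 / (2 * s)] *)
    have hm : `|h x - m x| <= s / 2 + F2 x.
      have -> : F2 x = `|h x - m x| ^+ 2 / (2 * s).
        by rewrite /F2 real_normK ?num_real// mulrC.
      set z := `|h x - m x|.
      have -> : s / 2 + z ^+ 2 / (2 * s) = z + (z - s) ^+ 2 / (2 * s).
        by field; rewrite gt_eqF.
      by rewrite lerDl divr_ge0 ?sqr_ge0// ltW// mulr_gt0.
    have := ler_distD (m x) (h x) (f x); have := mfb x; lra.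
  move=> h4 h3 h2 h1.
  have x1 : 1 <= (A ^+ 2)^-1 * x ^+ 2.
    rewrite mulrC ler_pdivlMr ?exprn_gt0// mul1r -[leRHS]real_normK ?num_real//.
    by rewrite lerXn2r ?nnegrE ?(ltW A0)// ltW.
  have e3 : `|h x| <= F3 x.
    by rewrite /F3 mulrA -[leLHS]mul1r ler_wpM2r.
  have e4 : f x <= F4 x.
    by rewrite /F4 mulrA -[leLHS]mul1r ler_wpM2r.
  have := ler_normB (h x) (f x); rewrite (ger0_norm (f0 x)); lra.
have xh0 x : 0 <= x ^+ 2 * `|h x| by apply: mulr_ge0 => //; exact: sqr_ge0.
have xf0 x : 0 <= x ^+ 2 * f x by apply: mulr_ge0 => //; exact: sqr_ge0.
rewrite ge0_integralD//; last by do 2 apply: emeasurable_funD => //.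
rewrite ge0_integralD//; last by apply: emeasurable_funD.
rewrite ge0_integralD//.
have -> : (\int[mu]_x (F1 x)%:E = (2 * A * (s / 2 + beta))%:E)%E.
  rewrite /F1; under eq_integral do rewrite EFinM.
  rewrite ge0_integralZl//.
    rewrite integral_indic// setIT.
    rewrite [X in (_ * X)%E](_ : _ = (2 * A)%:E); last first.
      transitivity (lebesgue_measure (`[- A, A]%classic : set R)); first by [].
      rewrite lebesgue_measure_itv/= lte_fin ifT; last by lra.
      by rewrite -EFinB; congr (_%:E); ring.
    by rewrite -EFinM mulrC.
  by apply/measurable_EFinP; exact: measurable_indic.
apply: leeD => //; apply: leeD.
  rewrite /F2; under eq_integral do rewrite EFinM.
  rewrite ge0_integralZl//; first exact/measurable_EFinP.
    by move=> x _; rewrite lee_fin sqr_ge0.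
  by rewrite lee_fin ltW.
rewrite ge0_muleDr; last 2 first.
- by apply: integral_ge0 => x _; rewrite lee_fin.
- by apply: integral_ge0 => x _; rewrite lee_fin.
apply: leeD.
  rewrite /F3; under eq_integral do rewrite EFinM.
  rewrite ge0_integralZl//; first exact/measurable_EFinP.
    by move=> x _; rewrite lee_fin.
  by rewrite lee_fin ltW.
rewrite /F4; under eq_integral do rewrite EFinM.
rewrite ge0_integralZl//; first exact/measurable_EFinP.
  by move=> x _; rewrite lee_fin.
  by rewrite lee_fin ltW.
all: by move=> x _; rewrite ?adde_ge0 ?lee_fin.
Qed.

End split.

(** * Integrability of the kernel, arithmetic of the rate, expected error *)

Section final_lemmas.
Context {R : realType}.
Local Notation mu := (@lebesgue_measure R).

Lemma eventually_bounded (u : nat -> R) (c : R) :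
  (\forall n \near \oo, u n <= c) -> exists2 B, 0 < B & forall n, u n <= B.
Proof.
move=> [n0 _ h]; exists (1 + `|c| + \sum_(i < n0) `|u i|).
  by rewrite ltr_wpDr ?sumr_ge0// ltr_wpDr.
move=> n; have s0 : 0 <= \sum_(i < n0) `|u i| by exact: sumr_ge0.
have [nn0|n0n] := ltnP n n0.
  have un : u n <= \sum_(i < n0) `|u i|.
    rewrite (bigD1 (Ordinal nn0))//=; apply: (le_trans (ler_norm _)).
    by rewrite lerDl sumr_ge0.
  by have := normr_ge0 c; lra.
by have := h n n0n; have := ler_norm c; rewrite /=; lra.
Qed.

(** On the interval between -1 and 1, [`|K u| <= 1 + K u ^+ 2]; outside it,
[`|K u| <= u ^+ 2 * `|K u|]. *)
Lemma kernel_integrable (K : R -> R) : measurable_fun setT K ->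
  (\int[mu]_u (u ^+ 2 * `|K u|)%:E < +oo)%E ->
  (\int[mu]_u (K u ^+ 2)%:E < +oo)%E ->
  (\int[mu]_u `|K u|%:E < +oo)%E.
Proof.
move=> mK K2 Ksq.
pose D : set R := `[- 1, 1]%classic.
have mD : measurable D by exact: measurable_itv.
have mi : measurable_fun setT (\1_D : R -> R) by exact: measurable_indic.
have mKs : measurable_fun setT (fun u => K u ^+ 2) by exact: measurable_funX.
have mK2 : measurable_fun setT (fun u : R => u ^+ 2 * `|K u|).
  by apply: measurable_funM; [exact: measurable_funX|exact: measurableT_comp].
have n2 u : 0 <= u ^+ 2 * `|K u| by apply: mulr_ge0 => //; exact: sqr_ge0.
have ns u : 0 <= K u ^+ 2 by exact: sqr_ge0.
have E1 : measurable_fun setT (EFin \o (\1_D : R -> R)) by exact/measurable_EFinP.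
have E2 : measurable_fun setT (fun u => (K u ^+ 2)%:E) by exact/measurable_EFinP.
have E3 : measurable_fun setT (fun u : R => (u ^+ 2 * `|K u|)%:E) by exact/measurable_EFinP.
apply: (@le_lt_trans _ _ (\int[mu]_u ((\1_D u)%:E + ((K u ^+ 2)%:E + (u ^+ 2 * `|K u|)%:E))%E)%E).
  apply: ge0_le_integral => //.
  - by apply/measurable_EFinP; exact: measurableT_comp.
  - by do 2 apply: emeasurable_funD => //.
  move=> u _; rewrite -!EFinD lee_fin.
  have := ns u; have := n2 u; rewrite indicE.
  have [u1|u1] := leP `|u| 1.
    rewrite mem_set /D/= ?in_itv/= -?ler_norml// => h1 h2.
    have : `|K u| <= 1 + K u ^+ 2.
      by rewrite -[K u ^+ 2]real_normK ?num_real//; have := sqr_ge0 (`|K u| - 1); nra.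
    lra.
  move=> h1 h2; have : `|K u| <= u ^+ 2 * `|K u|.
    rewrite ler_peMl// -[leRHS]real_normK ?num_real//.
    by rewrite -[leLHS](expr1n _ 2) lerXn2r ?nnegrE// ltW.
  by case: (_ \in _) => /=; lra.
have I1 : (\int[mu]_u (\1_D u)%:E < +oo)%E.
  rewrite integral_indic// setIT.
  rewrite [X in (X < _)%E](_ : _ = lebesgue_measure (`[- 1, 1]%classic : set R))//.
  by rewrite lebesgue_measure_itv/= lte_fin ifT ?ltry//; lra.
rewrite ge0_integralD//; last by apply: emeasurable_funD.
rewrite ge0_integralD//.
by apply: lte_add_pinfty => //; apply: lte_add_pinfty.
all: by move=> u _; rewrite ?adde_ge0 ?lee_fin.
Qed.

(** Choosing [A] as the power -1/3 of [b + s] balances [A * (b + s)] against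
[A ^- 2]. *)
Lemma rate_arithmetic (b s c1 C3 C5 C rm A : R) : 0 < b -> 0 < s -> 0 <= c1 ->
  0 <= C3 -> 0 <= C -> C <= C5 -> b + s <= rm ->
  A = (b + s) `^ (- (1 / 3)) ->
  2 * A * (s / 2 + c1 * b) + ((2 * s)^-1 * (C3 * s ^+ 2) + (A ^+ 2)^-1 * C) <=
  (1 + 2 * c1 + C3 * rm `^ (1 / 3) + C5) * (b + s) `^ (2 / 3).
Proof.
move=> b0 s0 c10 C30 C0 CC5 rrm AE.
set r := b + s; have r0 : 0 < r by rewrite addr_gt0.
have A0 : 0 < A by rewrite AE powR_gt0.
set q := r `^ (2 / 3); have q0 : 0 < q by exact: powR_gt0.
have Ar : A * r = q.
  rewrite AE -/r -[X in _ * X](powRr1 (ltW r0)) -powRD; last by apply/implyP => _; rewrite gt_eqF.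
  by rewrite /q; congr (_ `^ _); field.
have A2 : (A ^+ 2)^-1 = q.
  rewrite AE -/r -powR_mulrn ?powR_ge0// -powRrM -powRN /q.
  by congr (_ `^ _); field.
have rq : r <= rm `^ (1 / 3) * q.
  have rE : r `^ (1 / 3) * q = r.
    rewrite /q -powRD; last by apply/implyP => _; rewrite gt_eqF.
    by rewrite (_ : 1 / 3 + 2 / 3 = 1) ?powRr1 ?(ltW r0)//; field.
  rewrite -{1}rE; apply: ler_wpM2r; first exact: ltW.
  apply: ge0_ler_powR; rewrite ?nnegrE ?(ltW r0)//.
  exact: le_trans (ltW r0) rrm.
rewrite A2.
have -> : (2 * s)^-1 * (C3 * s ^+ 2) = C3 * (s / 2) by field; rewrite gt_eqF.
have e1 : 2 * A * (s / 2 + c1 * b) <= (1 + 2 * c1) * q.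
  rewrite -Ar; have As : 0 <= A * b by rewrite mulr_ge0// ltW.
  have As' : 0 <= c1 * (A * s) by rewrite mulr_ge0// mulr_ge0// ltW.
  rewrite /r; nra.
have e2 : C3 * (s / 2) <= C3 * rm `^ (1 / 3) * q.
  rewrite -mulrA; apply: ler_wpM2l => //; apply: le_trans rq; rewrite /r; lra.
have e3 : q * C <= C5 * q by rewrite mulrC; apply: ler_wpM2r => //; exact: ltW.
rewrite !mulrDl; rewrite mulrDl in e1; lra.
Qed.

Section expected.
Context {disp : measure_display} {T : measurableType disp}.
Variable P : probability T R.

Lemma expected_L1_split (h : T -> R -> R) (m f : R -> R) (A s beta v B S : R) :
  0 < A -> 0 < s ->
  measurable_fun setT (fun z : T * R => h z.1 z.2) ->
  measurable_fun setT m -> measurable_fun setT f ->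
  (forall x, 0 <= f x) -> 0 <= beta ->
  (forall x, `|m x - f x| <= beta) ->
  (\int[P]_w \int[mu]_x ((h w x - m x) ^+ 2)%:E <= v%:E)%E ->
  (\int[P]_w \int[mu]_x (x ^+ 2 * `|h w x|)%:E <= B%:E)%E ->
  (\int[mu]_x (x ^+ 2 * f x)%:E <= S%:E)%E ->
  (\int[P]_w \int[mu]_x `|h w x - f x|%:E <=
    (2 * A * (s / 2 + beta) + ((2 * s)^-1 * v + (A ^+ 2)^-1 * (B + S)))%:E)%E.
Proof.
move=> A0 s0 mh mm mf f0 beta0 mfb hv hB hS.
have A2 : 0 <= (A ^+ 2)^-1 by rewrite invr_ge0 sqr_ge0.
have s2 : 0 <= (2 * s)^-1 by rewrite invr_ge0 mulr_ge0// ltW.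
have c0 : 0 <= 2 * A * (s / 2 + beta).
  by rewrite mulr_ge0 ?mulr_ge0 ?addr_ge0 ?divr_ge0// ltW.
have mh1 w : measurable_fun setT (h w).
  by apply: (measurableT_comp mh (f := fun z : T * R => h z.1 z.2) (g := fun x => (w, x))); exact: measurable_pair1.
have msnd (g : R -> R) : measurable_fun setT g -> measurable_fun setT (fun z : T * R => g z.2).
  by move=> mg; exact: measurableT_comp.
have mF (F : T * R -> \bar R) : measurable_fun setT F -> (forall z, 0 <= F z)%E ->
    measurable_fun setT (fun w => \int[mu]_x F (w, x))%E.
  by move=> mF F0; exact: (@measurable_fun_fubini_tonelli_F _ _ _ _ R mu F).
have xh0 w x : 0 <= x ^+ 2 * `|h w x| by apply: mulr_ge0 => //; exact: sqr_ge0.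
have m1 : measurable_fun setT (fun w => \int[mu]_x `|h w x - f x|%:E)%E.
  apply: (mF (fun z => `|h z.1 z.2 - f z.2|%:E)) => //.
  apply/measurable_EFinP; apply: measurableT_comp => //.
  by apply: measurable_funB => //; exact: msnd.
have m2 : measurable_fun setT (fun w => \int[mu]_x ((h w x - m x) ^+ 2)%:E)%E.
  apply: (mF (fun z => ((h z.1 z.2 - m z.2) ^+ 2)%:E)) => // [|z].
    apply/measurable_EFinP; apply: measurable_funX.
    by apply: measurable_funB => //; exact: msnd.
  by rewrite lee_fin sqr_ge0.
have m3 : measurable_fun setT (fun w => \int[mu]_x (x ^+ 2 * `|h w x|)%:E)%E.
  apply: (mF (fun z => (z.2 ^+ 2 * `|h z.1 z.2|)%:E)) => // [|z].
    apply/measurable_EFinP; apply: measurable_funM; last exact: measurableT_comp.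
    by apply: measurable_funX.
  by rewrite lee_fin.
have i2 w : (0 <= \int[mu]_x ((h w x - m x) ^+ 2)%:E)%E.
  by apply: integral_ge0 => x _; rewrite lee_fin sqr_ge0.
have i3 w : (0 <= \int[mu]_x (x ^+ 2 * `|h w x|)%:E)%E.
  by apply: integral_ge0 => x _; rewrite lee_fin.
have Sf0 : (0 <= \int[mu]_x (x ^+ 2 * f x)%:E)%E.
  apply: integral_ge0 => x _; rewrite lee_fin.
  by apply: mulr_ge0 => //; exact: sqr_ge0.
have S0 : 0 <= S by rewrite -lee_fin; exact: le_trans hS.
pose c := 2 * A * (s / 2 + beta) + (A ^+ 2)^-1 * S.
have c_ge0 : 0 <= c by rewrite addr_ge0// mulr_ge0.
apply: (@le_trans _ _ (\int[P]_w (c%:E +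
   ((2 * s)^-1%:E * (\int[mu]_x ((h w x - m x) ^+ 2)%:E) +
    ((A ^+ 2)^-1)%:E * \int[mu]_x (x ^+ 2 * `|h w x|)%:E)))%E).
  apply: ge0_le_integral => //.
  - by move=> w _; exact: integral_ge0.
  - by apply: emeasurable_funD => //; apply: emeasurable_funD; exact: measurable_funeM.
  move=> w _; apply: (le_trans (L1_split A0 s0 (mh1 w) mm mf f0 beta0 mfb)).
  move: (i3 w) Sf0 hS => {}i3.
  set V := (_ * \int[mu]_x ((h w x - m x) ^+ 2)%:E)%E.
  set B' := (\int[mu]_x (x ^+ 2 * `|h w x|)%:E)%E in i3 *.
  set S' := (\int[mu]_x (x ^+ 2 * f x)%:E)%E => S'0 S'S.
  rewrite (ge0_muleDr _ i3 S'0) /c EFinD.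
  rewrite [(V + (_ + _))%E]addeA [(V + _ + _)%E]addeC [leLHS]addeA.
  by apply: leeD => //; apply: leeD => //; rewrite [leRHS]EFinM; exact: lee_wpmul2l.
have s2' : (0 <= (2 * s)^-1%:E)%E by rewrite lee_fin.
have A2' : (0 <= ((A ^+ 2)^-1)%:E)%E by rewrite lee_fin.
have mV : measurable_fun setT
    (fun w => (2 * s)^-1%:E * \int[mu]_x ((h w x - m x) ^+ 2)%:E)%E.
  exact: measurable_funeM.
have mB : measurable_fun setT
    (fun w => ((A ^+ 2)^-1)%:E * \int[mu]_x (x ^+ 2 * `|h w x|)%:E)%E.
  exact: measurable_funeM.
have V0 w : [set: T] w -> (0 <= (2 * s)^-1%:E * \int[mu]_x ((h w x - m x) ^+ 2)%:E)%E.
  by move=> _; exact: mule_ge0.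
have B0 w : [set: T] w -> (0 <= ((A ^+ 2)^-1)%:E * \int[mu]_x (x ^+ 2 * `|h w x|)%:E)%E.
  by move=> _; exact: mule_ge0.
have VB0 w : [set: T] w -> (0 <= (2 * s)^-1%:E * (\int[mu]_x ((h w x - m x) ^+ 2)%:E) +
    ((A ^+ 2)^-1)%:E * \int[mu]_x (x ^+ 2 * `|h w x|)%:E)%E.
  by move=> Tw; rewrite adde_ge0 ?V0 ?B0.
rewrite (ge0_integralD _ _ _ _ VB0 (emeasurable_funD mV mB))//.
rewrite (ge0_integralD _ _ V0 mV B0 mB)//.
rewrite !ge0_integralZl//.
rewrite integral_cst// [X in (_ * X)%E](_ : _ = 1%E) ?mule1; last exact: probability_setT.
rewrite (_ : 2 * A * (s / 2 + beta) + ((2 * s)^-1 * v + (A ^+ 2)^-1 * (B + S)) =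
  c + ((2 * s)^-1 * v + (A ^+ 2)^-1 * B)); last by rewrite /c; ring.
rewrite !EFinD; apply: leeD => //.
by apply: leeD; rewrite [leRHS]EFinM; exact: lee_wpmul2l.
Qed.

End expected.

End final_lemmas.

(** * The L1 error of a kernel density estimator *)

Section kde_bound.
Context {disp : measure_display} {T : measurableType disp} {R : realType}.
Variable P : probability T R.
Local Notation mu := (@lebesgue_measure R).
Variables (K : R -> R) (M L k0 k1 k2 : R).
Hypotheses (mK : measurable_fun setT K) (KM : forall x, `|K x| <= M).
Hypotheses (K0 : (\int[mu]_v `|K v|%:E <= k0%:E)%E)
  (K1 : (\int[mu]_v (`|v| * `|K v|)%:E <= k1%:E)%E)
  (K2 : (\int[mu]_v (v ^+ 2 * `|K v|)%:E <= k2%:E)%E)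
  (KI : (\int[mu]_v (K v)%:E = 1)%E)
  (L0 : 0 < L) (KL : forall x y, `|K x - K y| <= L * `|x - y|).
Variables (f : R -> R) (Lf S2 : R).
Hypotheses (Lf0 : 0 <= Lf) (fL : forall u v, `|f u - f v| <= Lf * `|u - v|).
Hypothesis fS2 : (\int[mu]_x (x ^+ 2 * f x)%:E = S2%:E)%E.
Variable b : R.
Hypothesis b0 : 0 < b.

(** The mean at [x] of a bump placed at random with density [f]. *)
Definition mean_bump (x : R) : R :=
  fine (\int[mu]_t ((kbump K b t x)%:E * (f t)%:E))%E.

Let k00 : 0 <= k0.
Proof. by rewrite -lee_fin; apply: le_trans K0; exact: integral_ge0. Qed.
Let k10 : 0 <= k1.
Proof.
by rewrite -lee_fin; apply: le_trans K1; apply: integral_ge0 => x _; rewrite lee_fin mulr_ge0.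
Qed.

Lemma mean_bumpE (Z : T -> R) (x : R) : measurable_fun setT Z -> is_density P Z f ->
  (\int[P]_w kbump K b (Z w) x)%R = mean_bump x.
Proof.
move=> mZ hZ; rewrite /Rintegral /mean_bump; congr fine.
exact: (integral_density mZ hZ (measurable_bump2 mK b x)).
Qed.

Variables (I : Type) (l : seq I) (X : I -> T -> R) (i0 : I) (C3 : R).
Hypothesis mX : forall i, measurable_fun setT (X i).
Hypothesis hX : forall i, is_density P (X i) f.

(** It is even Lipschitz, as an average of Lipschitz functions. *)
Lemma measurable_mean_bump : measurable_fun setT mean_bump.
Proof.
apply: continuous_measurable_fun; apply: (@lipschitz_continuous _ _ (L / b)).
  by rewrite divr_gt0.
move=> x x'; rewrite -!(mean_bumpE _ (mX i0) (hX i0)).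
have mb z : measurable_fun setT (fun w => kbump K b (X i0 w) z).
  exact: (measurableT_comp (measurable_bump2 mK b z)).
have ib z : P.-integrable setT (EFin \o (fun w => kbump K b (X i0 w) z)).
  by apply: (@integrable_bounded _ _ _ P _ M) => // w; exact: KM.
rewrite -(RintegralB measurableT (ib x) (ib x')).
apply: Rintegral_abs_le; first exact: measurable_funB.
apply: (@le_trans _ _ (\int[P]_w (cst (L / b * `|x - x'|)%:E w))%E); last first.
  rewrite integral_cst// [X in (_ * X)%E](_ : _ = 1%E) ?mule1//.
  exact: probability_setT.
apply: ge0_le_integral => //.
  by apply/measurable_EFinP; apply: measurableT_comp => //; exact: measurable_funB.
move=> w _; rewrite lee_fin; apply: (le_trans (KL _ _)).
rewrite -mulrA ler_wpM2l ?(ltW L0)// -mulrBl opprB addrA subrK normrM mulrC.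
by rewrite gtr0_norm ?invr_gt0.
Qed.

Hypothesis l0 : (0 < size l)%N.
Hypothesis iy2 : mu.-integrable setT (EFin \o (fun x => mean_bump x * mean_bump x)).
Hypothesis hV : \sum_(i <- l) \sum_(j <- l)
     ((\int[mu]_x cross P K b (X i) (X j) x) -
      \int[mu]_x (mean_bump x * mean_bump x))%R <= (size l)%:R * b * C3.

Local Notation N := ((size l)%:R : R).
Local Notation h w x := ((N * b)^-1 * \sum_(i <- l) K ((x - X i w) / b)).

Let Nb0 : 0 < N * b. Proof. by rewrite mulr_gt0// ltr0n. Qed.

(** The error at an arbitrary truncation level [A], for identically
distributed [X i] whose integrated covariances sum to at most [size l * b *
C3]. The default [i0] only witnesses that there is an index. *)
Lemma kde_L1_bound (A s : R) : 0 < A -> 0 < s -> s ^+ 2 = (N * b)^-1 ->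
  (\int[P]_w \int[mu]_x `|h w x - f x|%:E <=
    (2 * A * (s / 2 + Lf * k1 * b) +
     ((2 * s)^-1 * (C3 * s ^+ 2) +
      (A ^+ 2)^-1 * (2 * (S2 * k0 + b ^+ 2 * k2) + S2)))%:E)%E.
Proof.
move=> A0 s0 sE.
have [mf f0 _] := hX i0.
have mJ i : measurable_fun setT (fun z : T * R => K ((z.2 - X i z.1) / b)).
  apply: (measurableT_comp mK); apply: measurable_funM => //.
  by apply: measurable_funB => //; exact: measurableT_comp.
have mh : measurable_fun setT (fun z : T * R => h z.1 z.2).
  by apply: measurable_funM => //; exact: measurable_sum.
apply: (@expected_L1_split _ _ _ P (fun w x => h w x)
  (fun x => mean_bump x / b) f A s (Lf * k1 * b)) => //.
- by apply: measurable_funM => //; exact: measurable_mean_bump.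
- by rewrite mulr_ge0 ?mulr_ge0// ltW.
- move=> x; rewrite -(mean_bumpE _ (mX i0) (hX i0)) [leRHS]mulrAC.
  exact: (bias_le (k0 := k0) (k1 := k1)).
- have hE w x : (h w x - mean_bump x / b) ^+ 2 =
      (N * b)^-1 ^+ 2 * (\sum_(i <- l) (kbump K b (X i w) x - mean_bump x)) ^+ 2.
    rewrite -exprMn; congr (_ ^+ 2); rewrite big_split/= mulrDr; congr (_ + _).
    rewrite sumrN big_const_seq count_predT iter_addr_0 mulrN; congr (- _).
    by rewrite -mulr_natl; field; rewrite !gt_eqF// ltr0n.
  have sq0 : 0 <= (N * b)^-1 ^+ 2 by exact: sqr_ge0.
  have m1 w : measurable_fun setT
      (fun x => (\sum_(i <- l) (kbump K b (X i w) x - mean_bump x)) ^+ 2).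
    apply: measurable_funX; apply: measurable_sum => i.
    by apply: measurable_funB; [exact: measurable_bump1|exact: measurable_mean_bump].
  have -> : (\int[P]_w \int[mu]_x ((h w x - mean_bump x / b) ^+ 2)%:E =
     ((N * b)^-1 ^+ 2)%:E * \int[P]_w \int[mu]_x
       ((\sum_(i <- l) (kbump K b (X i w) x - mean_bump x)) ^+ 2)%:E)%E.
    rewrite -ge0_integralZl//; last 2 first.
    - apply: (@measurable_fun_fubini_tonelli_F _ _ _ _ R mu
        (fun z : T * R => ((\sum_(i <- l) (kbump K b (X i z.1) z.2 - mean_bump z.2)) ^+ 2)%:E)) => [|z].
        apply/measurable_EFinP; apply: measurable_funX; apply: measurable_sum => i.
        by apply: measurable_funB; [exact: mJ|exact: (measurableT_comp measurable_mean_bump)].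
      by rewrite lee_fin sqr_ge0.
    - by move=> w _; apply: integral_ge0 => x _; rewrite lee_fin sqr_ge0.
    apply: eq_integral => w _; rewrite -ge0_integralZl//.
    - by apply: eq_integral => x _; rewrite hE EFinM.
    - by apply/measurable_EFinP; exact: m1.
    - by move=> x _; rewrite lee_fin sqr_ge0.
  rewrite (integrated_variance mK KM K0 b0 l mX
    (fun i x => mean_bumpE x (mX i) (hX i)) measurable_mean_bump iy2).
  rewrite -EFinM lee_fin sE.
  apply: (le_trans (ler_wpM2l sq0 hV)).
  rewrite le_eqVlt; apply/orP; left; apply/eqP; field.
  by rewrite !gt_eqF// ltr0n.
- have mb w i : measurable_fun setT (fun x : R => x ^+ 2 * `|kbump K b (X i w) x|).
    apply: measurable_funM; first exact: measurable_funX.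
    by apply: measurableT_comp => //; exact: measurable_bump1.
  have nb w i x : 0 <= x ^+ 2 * `|kbump K b (X i w) x|.
    by apply: mulr_ge0 => //; exact: sqr_ge0.
  have Nbi : 0 <= (N * b)^-1 by rewrite invr_ge0 ltW.
  pose g i w := (N * b)^-1 * (b * (2 * (X i w ^+ 2 * k0 + b ^+ 2 * k2))).
  have k20 : 0 <= k2.
    rewrite -lee_fin; apply: le_trans K2; apply: integral_ge0 => x _.
    by rewrite lee_fin mulr_ge0// sqr_ge0.
  have g0 i w : 0 <= g i w.
    apply: mulr_ge0 => //; apply: mulr_ge0; first exact: ltW.
    by apply: mulr_ge0 => //; apply: addr_ge0; apply: mulr_ge0 => //; exact: sqr_ge0.
  have mg i : measurable_fun setT (fun w => (g i w)%:E).
    apply/measurable_EFinP; do 3 apply: measurable_funM => //.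
    by apply: measurable_funD => //; apply: measurable_funM => //; exact: measurable_funX.
  have gE i : (\int[P]_w (g i w)%:E =
      ((N * b)^-1 * (b * (2 * (S2 * k0 + b ^+ 2 * k2))))%:E)%E.
    have X2 : (\int[P]_w (X i w ^+ 2)%:E = S2%:E)%E.
      rewrite -fS2 (ge0_integral_density (mX i) (hX i) (phi := fun x => (x ^+ 2)%:E)).
      - by apply: eq_integral => x _; rewrite EFinM.
      - by apply/measurable_EFinP; exact: measurable_funX.
      - by move=> x; rewrite lee_fin sqr_ge0.
    pose c1 := (N * b)^-1 * (b * (2 * k0)).
    pose c2 := (N * b)^-1 * (b * (2 * (b ^+ 2 * k2))).
    have c10 : 0 <= c1.
      by apply: mulr_ge0 => //; apply: mulr_ge0; [exact: ltW|apply: mulr_ge0].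
    have c20 : 0 <= c2.
      apply: mulr_ge0 => //; apply: mulr_ge0; first exact: ltW.
      by apply: mulr_ge0 => //; apply: mulr_ge0 => //; exact: sqr_ge0.
    have mX2 : measurable_fun setT (fun w => X i w ^+ 2) by exact: measurable_funX.
    transitivity (\int[P]_w (c1%:E * (X i w ^+ 2)%:E + cst c2%:E w))%E.
      apply: eq_integral => w _; rewrite -EFinM -EFinD; congr (_%:E).
      by rewrite /g /c1 /c2; ring.
    rewrite ge0_integralD//.
    - rewrite ge0_integralZl//.
      + rewrite X2 integral_cst// [X in (_ + _ * X)%E](_ : _ = 1%E).
          by rewrite mule1 -EFinM -EFinD; congr (_%:E); rewrite /c1 /c2; ring.
        exact: probability_setT.
      + exact/measurable_EFinP.
      + by move=> w _; rewrite lee_fin sqr_ge0.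
    - by move=> w _; rewrite -EFinM lee_fin mulr_ge0// sqr_ge0.
    - by apply/measurable_EFinP; exact: measurable_funM.
  apply: (@le_trans _ _ (\int[P]_w \sum_(i <- l) (g i w)%:E)%E).
    apply: ge0_le_integral => //.
    - move=> w _; apply: integral_ge0 => x _.
      by rewrite lee_fin mulr_ge0// sqr_ge0.
    - apply: (@measurable_fun_fubini_tonelli_F _ _ _ _ R mu
        (fun z : T * R => (z.2 ^+ 2 * `|h z.1 z.2|)%:E)) => [|z].
        apply/measurable_EFinP; apply: measurable_funM; first exact: measurable_funX.
        exact: measurableT_comp.
      by rewrite lee_fin mulr_ge0// sqr_ge0.
    - by apply: emeasurable_sum => i; exact: mg.
    move=> w _.
    apply: (@le_trans _ _ (\int[mu]_x \sum_(i <- l)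
        ((N * b)^-1%:E * (x ^+ 2 * `|kbump K b (X i w) x|)%:E))%E).
      apply: ge0_le_integral => //.
      - by move=> x _; rewrite lee_fin mulr_ge0// sqr_ge0.
      - apply/measurable_EFinP; apply: measurable_funM; first exact: measurable_funX.
        apply: measurableT_comp => //; apply: measurable_funM => //.
        by apply: measurable_sum => i; exact: measurable_bump1.
      - apply: emeasurable_sum => i; apply/measurable_EFinP.
        by apply: measurable_funM => //; exact: mb.
      move=> x _.
      rewrite [leRHS](eq_bigr (fun i => ((N * b)^-1 *
        (x ^+ 2 * `|kbump K b (X i w) x|))%:E)); last by [].
      rewrite sumEFin lee_fin -mulr_sumr -mulr_sumr normrM (ger0_norm Nbi).
      rewrite mulrCA; apply: ler_wpM2l => //; apply: ler_wpM2l; first exact: sqr_ge0.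
      exact: ler_norm_sum.
    rewrite ge0_integral_sum//; last 2 first.
    - move=> i; apply/measurable_EFinP.
      by apply: measurable_funM => //; exact: mb.
    - by move=> i x _; rewrite -EFinM lee_fin mulr_ge0.
    apply: lee_sum => i _; rewrite ge0_integralZl//; last 2 first.
    - by apply/measurable_EFinP; exact: mb.
    - by move=> x _; rewrite lee_fin.
    rewrite [leRHS]EFinM; apply: lee_wpmul2l; first by rewrite lee_fin.
    exact: (second_moment_bump mK K0 K2 b0).
  rewrite ge0_integral_sum//; last by move=> i w _; rewrite lee_fin.
  under eq_bigr do rewrite gE.
  rewrite sumEFin lee_fin big_const_seq count_predT iter_addr_0 -mulr_natl.
  by rewrite le_eqVlt; apply/orP; left; apply/eqP; field; rewrite !gt_eqF// ltr0n.
- by rewrite fS2.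
Qed.

End kde_bound.

(** * Rate of convergence for the random field *)

Section field.
Context {disp : measure_display} {T : measurableType disp} {R : realType}.
Variable P : probability T R.
Local Notation mu := (@lebesgue_measure R).
Variables (d : nat) (g : (lattice d -> R) -> R).
Variables (eps eps' : lattice d -> {RV P >-> R}).
Hypotheses (heps : iid eps) (heps' : iid_copy eps eps').
Hypothesis hg : measurable_fun [set: product_space R (lattice d)]
            (g : product_space R (lattice d) -> R).
Variable f : R -> R.
Hypothesis hf : forall i, is_density P (random_field g eps i) f.
Hypothesis hL1 : forall i, (\int[P]_w `|random_field g eps i w|%:E < +oo)%E.
Variable p : R.
Hypothesis p0 : 0 <= p.
Hypothesis hdelta : (\esum_(i in [set: lattice d])
        (((sup_norm i)%:R `^ p)%:E * phys_dep g 2 eps eps' i) < +oo)%E.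

Lemma measurable_field (e : lattice d -> {RV P >-> R}) i :
  measurable_fun setT (random_field g e i).
Proof.
have mS : measurable_fun setT
    (fun w => (fun s => e (i - s) w) : product_space R (lattice d)).
  exact: (@measurable_family R _ T _ (fun s w => e (i - s) w)).
exact: (measurableT_comp hg mS).
Qed.

(** The independent coupling in terms of the coefficients of order 2, which
dominate those of order 1. *)
Lemma coupled_pair : exists2 C : R, 0 < C & forall i j, i != j ->
  exists X X' : {RV P >-> R}, [/\ indep_rv P X X', is_density P X f,
    is_density P X' f &
    (\int[P]_w `|random_field g eps i w - X w|%:E +
     \int[P]_w `|random_field g eps j w - X' w|%:E <=
       (C * (sup_norm (i - j))%:R `^ (- p))%:E)%E].
Proof.
set S := (\esum_(i in [set: lattice d]) (((sup_norm i)%:R `^ p)%:E * dep1 g eps eps' i))%E.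
have S0 : (0 <= S)%E.
  by apply: esum_ge0 => i _; rewrite mule_ge0 ?lee_fin ?powR_ge0// integral_ge0.
have Soo : (S < +oo)%E.
  apply: le_lt_trans hdelta; apply: le_esum => i _.
  apply: lee_wpmul2l; first by rewrite lee_fin powR_ge0.
  apply: le_L1_L2; apply: measurable_funB; exact: measurable_field.
have Sfin : S = (fine S)%:E by rewrite fineK// ge0_fin_numE.
have s0 : 0 <= fine S by exact: fine_ge0.
exists (2 * (fine S + 1) * 2^-1 `^ (- p)).
  by rewrite mulr_gt0 ?powR_gt0// mulr_gt0// ltr_wpDl.
move=> i j ij.
have [X [X' [[mX mX'] XX' [lX lX'] dX dX']]] :=
  independent_coupling heps heps' hg hL1 ij p0.
pose Y : {RV P >-> R} := HB.pack X (isMeasurableFun.Build _ _ _ _ X mX).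
pose Y' : {RV P >-> R} := HB.pack X' (isMeasurableFun.Build _ _ _ _ X' mX').
exists Y, Y'; split => //.
- have [mf f0 Xf] := hf i; split => // A mA.
  by rewrite lX// Xf.
- have [mf f0 Xf] := hf j; split => // A mA.
  by rewrite lX'// Xf.
rewrite -/S Sfin in dX dX'.
set r := (sup_norm (i - j))%:R in dX dX' *.
have r0 : 0 < r :> R by rewrite ltr0n lt0n sup_norm_eq0 subr_eq0.
have rp : 0 < (r / 2) `^ p by rewrite powR_gt0// divr_gt0.
have bnd (z : \bar R) : (((r / 2) `^ p)%:E * z <= (fine S)%:E)%E ->
    (z <= ((fine S + 1) * (2^-1 `^ (- p) * r `^ (- p)))%:E)%E.
  rewrite -lee_pdivlMl// -EFinM => /le_trans; apply.
  have half0 : 0 <= 2^-1 :> R by rewrite invr_ge0.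
  rewrite lee_fin -powRN (powRM _ (ltW r0) half0).
  rewrite [leLHS]mulrC [X in _ * X <= _]mulrC; apply: ler_wpM2r; last by rewrite lerDl.
  by apply: mulr_ge0; exact: powR_ge0.
apply: (le_trans (leeD (bnd _ dX) (bnd _ dX'))).
by rewrite -EFinD lee_fin le_eqVlt; apply/orP; left; apply/eqP; ring.
Qed.

End field.

Theorem theorem1 (R : realType) (disp : measure_display)
    (T : measurableType disp) (P : probability T R)
    (d : nat) (hd : (1 <= d)%N)
    (eps eps' : lattice d -> {RV P >-> R})
    (heps : iid eps) (heps' : iid_copy eps eps')
    (g : (lattice d -> R) -> R)
    (hg : measurable_fun [set: product_space R (lattice d)]
            (g : product_space R (lattice d) -> R))
    (f : R -> R) (hf : forall i, is_density P (random_field g eps i) f)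
    (hL2 : forall i, random_field g eps i \in Lfun P 2%:E)
    (Lambda : nat -> {fset lattice d})
    (hLambda : forall n, (1 <= n)%N -> Lambda n != fset0)
    (b : nat -> R) (hb : forall n, (1 <= n)%N -> 0 < b n)
    (K : R -> R)
    (hflip : lipschitz f)
    (hKlip : lipschitz K)
    (hK1 : (\int[lebesgue_measure]_u (K u)%:E = 1)%E)
    (hK2 : (\int[lebesgue_measure]_u (u ^+ 2 * `|K u|)%:E < +oo)%E)
    (hKsq : (\int[lebesgue_measure]_u (K u ^+ 2)%:E < +oo)%E)
    (hb0 : b n @[n --> \oo] --> (0 : R))
    (hLambdaoo : (#|` Lambda n|%:R : R) @[n --> \oo] --> +oo)
    (hLambdab : (#|` Lambda n|%:R * b n) @[n --> \oo] --> +oo)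
    (hdelta : (\esum_(i in [set: lattice d])
        (((sup_norm i)%:R `^ (5 * d%:R / 2))%:E *
          phys_dep g 2 eps eps' i) < +oo)%E) :
  exists2 kappa : R, 0 < kappa &
    forall n, (1 <= n)%N ->
      (\int[P]_w \int[lebesgue_measure]_x
          `|kde (random_field g eps) K (Lambda n) (b n) w x - f x|%:E
        <= (kappa *
            (b n + (Num.sqrt (#|` Lambda n|%:R * b n))^-1) `^ (2 / 3))%:E)%E.
Proof.
set X := random_field g eps.
have mX i : measurable_fun setT (X i) by exact: measurable_field.
have PT : P setT \is a fin_num by rewrite probability_setT.
have hL1 i : (\int[P]_w `|X i w|%:E < +oo)%E.
  have /Lfun1_integrable/integrableP[_] := Lfun_subset12 PT (hL2 i).
  by [].
have [mf f0 _] := hf 0.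
have iX2 : (\int[P]_w (X 0 w ^+ 2)%:E < +oo)%E.
  have /integrableP[_] := Lfun2_integrable_sqr (hL2 0).
  apply: le_lt_trans; apply: ge0_le_integral => //.
  - by move=> w _; rewrite lee_fin sqr_ge0.
  - by apply/measurable_EFinP; exact: measurable_funX.
  - apply: measurableT_comp => //; apply/measurable_EFinP; exact: measurable_funX.
  - by move=> w _; rewrite /= lee_fin ler_norm.
have x2f : (\int[P]_w (X 0%R w ^+ 2)%:E =
    \int[lebesgue_measure]_x (x ^+ 2 * f x)%:E)%E.
  rewrite (ge0_integral_density (mX 0) (hf 0) (phi := fun x => (x ^+ 2)%:E)).
  - by apply: eq_integral => x _; rewrite EFinM.
  - by apply/measurable_EFinP; exact: measurable_funX.
  - by move=> x; rewrite lee_fin sqr_ge0.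
pose S2 := fine (\int[P]_w (X 0%R w ^+ 2)%:E)%E.
have iX20 : (0 <= \int[P]_w (X 0%R w ^+ 2)%:E)%E.
  by apply: integral_ge0 => w _; rewrite lee_fin sqr_ge0.
have fS2 : (\int[lebesgue_measure]_x (x ^+ 2 * f x)%:E = S2%:E)%E.
  by rewrite -x2f /S2 fineK// ge0_fin_numE.
have S20 : 0 <= S2 by exact: fine_ge0.
have [Lf Lf0 fL] := lipschitz_ex hflip.
have f1 := density_integral1 (hf 0).
have fM : forall x, f x <= 1 + Lf.
  by apply: (lipschitz_integrable_bounded Lf0 f0 fL); rewrite f1.
have [L L0 KL] := lipschitz_ex hKlip.
have mK : measurable_fun setT K.
  by apply: continuous_measurable_fun; exact: lipschitz_continuous L0 KL.
have mnK : measurable_fun setT (fun v => `|K v|) by exact: measurableT_comp.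
have iK := kernel_integrable mK hK2 hKsq.
pose k0 := fine (\int[lebesgue_measure]_u `|K u|%:E)%E.
pose k2 := fine (\int[lebesgue_measure]_u (u ^+ 2 * `|K u|)%:E)%E.
have uK0 (u : R) : 0 <= u ^+ 2 * `|K u| by apply: mulr_ge0 => //; exact: sqr_ge0.
have I0 : (\int[lebesgue_measure]_u `|K u|%:E = k0%:E)%E.
  by rewrite fineK// ge0_fin_numE// integral_ge0.
have I2 : (\int[lebesgue_measure]_u (u ^+ 2 * `|K u|)%:E = k2%:E)%E.
  by rewrite fineK// ge0_fin_numE// integral_ge0// => u _; rewrite lee_fin.
have k00 : 0 <= k0 by apply: fine_ge0; exact: integral_ge0.
have k20 : 0 <= k2 by apply: fine_ge0; apply: integral_ge0 => u _; rewrite lee_fin.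
have K0 : (\int[lebesgue_measure]_v `|K v|%:E <= k0%:E)%E by rewrite I0.
have K2 : (\int[lebesgue_measure]_v (v ^+ 2 * `|K v|)%:E <= k2%:E)%E by rewrite I2.
(* [`|v| <= 1 + v ^+ 2] *)
pose k1 := k0 + k2.
have k10 : 0 <= k1 by exact: addr_ge0.
have K1 : (\int[lebesgue_measure]_v (`|v| * `|K v|)%:E <= k1%:E)%E.
  rewrite /k1 EFinD -I0 -I2 -ge0_integralD//; last 3 first.
  - exact/measurable_EFinP.
  - by move=> v _; rewrite lee_fin.
  - apply/measurable_EFinP; apply: measurable_funM => //; exact: measurable_funX.
  apply: ge0_le_integral => //.
  - by apply/measurable_EFinP; apply: measurable_funM => //; exact: measurableT_comp.
  - apply: emeasurable_funD; apply/measurable_EFinP => //.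
    by apply: measurable_funM => //; exact: measurable_funX.
  move=> v _; rewrite -EFinD lee_fin -[X in _ <= X + _]mul1r -mulrDl.
  apply: ler_wpM2r => //; rewrite -[v ^+ 2]real_normK ?num_real//.
  by have := sqr_ge0 (`|v| - 1); nra.
pose M := k0 + L.
have KM : forall x, `|K x| <= M.
  apply: (@lipschitz_integrable_bounded _ (fun x => `|K x|) L k0) => //.
  by move=> x y; apply: le_trans (KL x y); exact: ler_dist_dist.
have M0 : 0 <= M by rewrite addr_ge0// ltW.
pose p : R := 5 * d%:R / 2.
have p0 : 0 <= p by rewrite divr_ge0 ?mulr_ge0.
have [C C0 pairs] := coupled_pair heps heps' hg hf hL1 p0 hdelta.
pose C2 := cov_const M L k0 k1 * C `^ (3 / 7) * (2 + 8 * (1 + Lf)).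
have C20 : 0 <= C2.
  apply: mulr_ge0; last by rewrite addr_ge0// mulr_ge0// addr_ge0// ltW.
  by apply: mulr_ge0; [exact: ltW (cov_const_gt0 KM K0 K1 KL)|exact: powR_ge0].
(* the exponent of the covariances is [p * (3 / 7) = d * (1 + 1 / 14)] *)
pose a : R := 1 / 14.
have a0 : 0 < a by rewrite divr_gt0.
pose y (n : nat) := mean_bump K f (b n).
have cov_le n i j : (1 <= n)%N -> i != j ->
  (lebesgue_measure.-integrable setT (EFin \o (fun x => y n x * y n x))) /\
  (\int[lebesgue_measure]_x cross P K (b n) (X i) (X j) x)%R -
    (\int[lebesgue_measure]_x (y n x * y n x))%R <=
  b n * C2 * (sup_norm (i - j))%:R `^ (- (d%:R * (1 + a))).
  move=> n1 ij; have bn0 := hb n n1.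
  have [Y [Y' [YY' hY hY' dYY']]] := pairs i j ij.
  have mY : measurable_fun setT Y by exact: measurable_funP.
  have mY' : measurable_fun setT Y' by exact: measurable_funP.
  have yE : (fun x => y n x * y n x) = cross P K (b n) Y Y'.
    apply/funext => x; rewrite (cross_indep mK KM (b n) YY').
    by rewrite (mean_bumpE mK _ x mY hY) (mean_bumpE mK _ x mY' hY').
  rewrite yE; split; first exact: (integrable_cross P mK KM K0 bn0 mY mY').
  have r0 : 0 < (sup_norm (i - j))%:R :> R by rewrite ltr0n lt0n sup_norm_eq0 subr_eq0.
  have D0 : 0 < C * (sup_norm (i - j))%:R `^ (- p) by rewrite mulr_gt0// powR_gt0.
  apply: (le_trans (Rintegral_cross_diff mK KM K0 K1 KL bn0 (mX i) (mX j) hY' YY' fM D0 dYY')).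
  rewrite powRM ?powR_ge0 ?(ltW C0)// -powRrM.
  rewrite (_ : - p * (3 / 7) = - (d%:R * (1 + a))); last by rewrite /p /a; field.
  by rewrite le_eqVlt; apply/orP; left; apply/eqP; rewrite /C2; ring.
have iy2 n : (1 <= n)%N -> lebesgue_measure.-integrable setT (EFin \o (fun x => y n x * y n x)).
  move=> n1.
  (* any two distinct sites will do; they exist because [0 < d] *)
  have ij : (0 : lattice d) != const_mx 1.
    apply/eqP => /rowP /(_ (Ordinal hd)); rewrite !mxE => h.
    by [].
  by have [] := cov_le n _ _ n1 ij.
(* the diagonal and the off-diagonal terms *)
pose C3 := M * k0 + C2 * (2 * (2 + a^-1)) ^+ d.
have a1 : 0 <= 2 * (2 + a^-1) by rewrite mulr_ge0// addr_ge0// invr_ge0 ltW.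
have C30 : 0 <= C3.
  by apply: addr_ge0; apply: mulr_ge0 => //; exact: exprn_ge0.
have var_le n : (1 <= n)%N ->
  \sum_(i <- enum_fset (Lambda n)) \sum_(j <- enum_fset (Lambda n))
     ((\int[lebesgue_measure]_x cross P K (b n) (X i) (X j) x) -
      \int[lebesgue_measure]_x (y n x * y n x))%R <=
   (size (enum_fset (Lambda n)))%:R * b n * C3.
  move=> n1; have bn0 := hb n n1; set l := enum_fset _.
  have ul : uniq l by exact: fset_uniq.
  apply: (@le_trans _ _ (\sum_(i <- l) b n * C3)); last first.
    by rewrite big_const_seq count_predT iter_addr_0 -[leLHS]mulr_natl mulrA.
  rewrite big_seq [leRHS]big_seq; apply: ler_sum => i il.
  rewrite (bigD1_seq i)//= /C3 mulrDr; apply: lerD.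
    have y2 : 0 <= (\int[lebesgue_measure]_x (y n x * y n x))%R.
      by apply: Rintegral_ge0 => x _; rewrite -expr2 sqr_ge0.
    apply: (@le_trans _ _ (\int[lebesgue_measure]_x cross P K (b n) (X i) (X i) x)%R).
      by rewrite gerDl oppr_le0.
    rewrite (Rintegral_cross P mK KM K0 bn0 (mX i) (mX i)).
    under eq_Rintegral do rewrite subrr mul0r.
    rewrite Rintegral_prob_cst ler_pM2l//.
    exact: (le_trans (ler_norm _) (autocorr_bounded mK KM K0 0)).
  under eq_bigl do rewrite eq_sym.
  apply: (@le_trans _ _ (\sum_(j <- l | i != j)
      b n * C2 * (sup_norm (i - j))%:R `^ (- (d%:R * (1 + a))))).
    by apply: ler_sum => j ij; have [] := cov_le n i j n1 ij.
  rewrite -mulr_sumr -mulrA ler_pM2l//; apply: ler_wpM2l => //.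
  exact: lattice_sum.
(* [b n] and [s n] are bounded, as they converge; their bounds [Bb] and [Bs]
   enter the constant *)
pose s n : R := (Num.sqrt (#|` Lambda n|%:R * b n))^-1.
have [Bb Bb0 bB] : exists2 B, 0 < B & forall n, b n <= B.
  apply: (@eventually_bounded _ _ 1).
  exact: (cvgr_le (0 : R) hb0 1 ltr01).
have [Bs Bs0 sB] : exists2 B, 0 < B & forall n, s n <= B.
  apply: (@eventually_bounded _ _ 1).
  move/cvgryPge: hLambdab => /(_ 1); apply: filterS => n h1.
  have s1 : 1 <= Num.sqrt (#|` Lambda n|%:R * b n) by rewrite -[leLHS]sqrtr1 ler_wsqrtr.
  by rewrite /s invf_le1// (lt_le_trans ltr01).
pose c1 := Lf * k1.
pose C5 := 2 * (S2 * k0 + Bb ^+ 2 * k2) + S2.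
have c10 : 0 <= c1 by rewrite mulr_ge0// ltW.
have C50 : 0 <= C5.
  by rewrite addr_ge0// mulr_ge0// addr_ge0// mulr_ge0// sqr_ge0.
exists (1 + 2 * c1 + C3 * (Bb + Bs) `^ (1 / 3) + C5).
  have := mulr_ge0 C30 (powR_ge0 (Bb + Bs) (1 / 3)); lra.
move=> n n1.
have bn0 := hb n n1.
have size0 : (0 < size (enum_fset (Lambda n)))%N.
  by rewrite lt0n; have := hLambda n n1; rewrite -cardfs_eq0.
have Nb0 : 0 < #|` Lambda n|%:R * b n by rewrite mulr_gt0// ltr0n.
have s0 : 0 < s n by rewrite invr_gt0 sqrtr_gt0.
have sE : s n ^+ 2 = (#|` Lambda n|%:R * b n)^-1.
  by rewrite /s exprVn sqr_sqrtr// ltW.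
pose A := (b n + s n) `^ (- (1 / 3)).
have A0 : 0 < A by rewrite powR_gt0// addr_gt0.
have := kde_L1_bound mK KM K0 K1 K2 hK1 L0 KL (ltW Lf0) fL fS2 bn0 (0 : lattice d)
  mX hf size0 (iy2 n n1) (var_le n n1) A0 s0 sE.
move=> /le_trans; apply; rewrite lee_fin -/(s n).
apply: rate_arithmetic => //.
- by rewrite addr_ge0// mulr_ge0// addr_ge0// mulr_ge0// sqr_ge0.
- rewrite lerD2r ler_pM2l// lerD2l ler_wpM2r//.
  by rewrite lerXn2r ?nnegrE ?(ltW bn0) ?(ltW Bb0).
- by apply: lerD; [exact: bB|exact: sB].
Qed.
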